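(* Let $\alpha\in(0,1)$. The function $$x\mapsto\frac{e^{x^{1/\alpha}}}{\alpha}-E_\alpha(x)$$ is completely monotonic on $(0,+\infty)$ if and only if $\alpha\ge 1/2$.
   Context: A smooth function $f$ on $(0,+\infty)$ is completely monotonic (CM) if $(-1)^n f^{(n)}(x)\ge 0$ for all $n\ge 0$ and $x>0$. The Mittag-Leffler function is $E_\alpha(z)=\sum_{n\ge 0}\frac{z^n}{\Gamma(1+\alpha n)}$. *)

(* Defs.v *)
From mathcomp Require Import all_boot all_order all_algebra.
From mathcomp Require Import all_classical all_reals all_analysis.

Set Implicit Arguments.
Unset Strict Implicit.
Unset Printing Implicit Defensive.

Import Order.TTheory GRing.Theory Num.Theory.
Import numFieldNormedType.Exports.

Local Open Scope classical_set_scope.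
Local Open Scope ring_scope.

(* [derive1n] is total in the library, so smoothness is required explicitly:
   every iterated derivative is differentiable on the open half-line. Values of
   [f] outside of it are irrelevant, as derivatives are local. *)
Definition completely_monotonic (R : realType) (f : R -> R) : Prop :=
  (forall (n : nat) (x : R), 0 < x -> derivable (derive1n n f) x 1) /\
  (forall (n : nat) (x : R), 0 < x -> 0 <= (-1) ^+ n * derive1n n f x).

(* Euler's integral; it is the Gamma function only for [0 < s], the integral
   being infinite (and [Rintegral] then returning 0) otherwise. *)
Definition Gamma (R : realType) (s : R) : R :=
  \int[@lebesgue_measure R]_(t in `]0, +oo[) (t `^ (s - 1) * expR (- t)).

(* [pseries c z] is the sequence of partial sums of [\sum_n c n * z ^+ n]. For
   [0 < a] the series converges for every [z], so [lim] is its sum. *)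
Definition mittag_leffler (R : realType) (a z : R) : R :=
  limn (pseries (fun n : nat => (Gamma (1 + a * n%:R))^-1) z).

(* Main.v *)
Require Import Defs.
From mathcomp Require Import all_boot all_order all_algebra.
From mathcomp Require Import all_classical all_reals all_analysis.
From mathcomp Require Import measurable_realfun ring lra.

(** Write [b = alpha^-1] and let [F] be the function of the theorem.

    Necessity. If [alpha < 1 / 2] then [2 < b], so the second derivative of the
    exponential term tends to 0 as [x] decreases to 0, whereas the second
    derivative of the Mittag-Leffler series is at least [2 / Gamma (1 + 2 alpha)]
    on the positive half-line. Hence [F] has a negative second derivative near 0
    ([exp_ml_gap_alpha_ge]).

    Sufficiency. For [1 < b <= 2], [x `^ b] is the Laplace exponent of a spectrally
    negative stable process: its bilateral Laplace transform at time [t] is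
    [exp (t * x `^ b)], and [alpha * F] is the part of that transform at time 1
    carried by the negative half-line. The argument below makes this elementary.

    - In the time-Laplace variable [q], the negative part of [1 / (q - x `^ b)]
      is obtained by subtracting its polar part at [x = p], [p `^ b = q]; for a
      product of such resolvents with distinct [q]'s one subtracts the polar part
      at every [p] ([resolvent_part]). Now [1 / (q - x `^ b)] is [1 / (p - x)]
      times the inverse of the slope [(p `^ b - x `^ b) / (p - x)], and
      subtracting the polar parts amounts to taking an iterated divided
      difference of the product of the inverse slopes ([divdiffE]).
    - After the substitution [x = (1 - s) / h], the inverse slopes become
      absolutely monotone in [s]: the slope is a constant minus a divided
      difference of [(1 - s) `^ b - 1 + b * s], whose second derivative
      [b * (b - 1) * (1 - s) `^ (b - 2)] is absolutely monotone exactly because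
      [b <= 2] ([absmon_onem_powR]). Absolute monotonicity is stable under
      products, divided differences and geometric series, so [resolvent_part] is
      absolutely monotone in [s]. Taking [s = exp (- h x)] and letting [h] tend
      to 0, its alternating differences in [x] are nonnegative
      ([altdiff_resolvent_part_ge0]).
    - With [n + 1] nodes [q] clustered just above [n + 1], the resolvent parts,
      suitably normalized, converge to [F] (a discrete form of the Post-Widder
      inversion formula, [cvg_resolvent_part_exp_ml_gap]): the product of the
      resolvents tends to [exp (x `^ b)], and the polar part is a power series
      whose coefficients tend to those of the Mittag-Leffler function, by
      Euler's limit formula for the Gamma function; the limit is taken termwise
      by Tannery's theorem.
    - So the alternating differences of [F] are nonnegative, and as [F] is
      smooth, the mean value theorem for iterated differences
      ([altdiff_mean_value]) gives the signs of its derivatives. *)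

Set Implicit Arguments.
Unset Strict Implicit.
Unset Printing Implicit Defensive.

Import Order.TTheory GRing.Theory Num.Theory.
Import numFieldNormedType.Exports.

Local Open Scope classical_set_scope.
Local Open Scope ring_scope.

(** * Limits and derivatives of finite sums, and Tannery's theorem *)

Section Calc.
Context {R : realType}.
Implicit Types (f g df : R -> R).

Lemma cvg_sum_seq (T : Type) (F : set_system T) {FF : Filter F} (I : eqType)
    (r : seq I) (u : I -> T -> R) (l : I -> R) :
  (forall i, i \in r -> u i x @[x --> F] --> l i) ->
  \sum_(i <- r) u i x @[x --> F] --> \sum_(i <- r) l i.
Proof.
elim: r => [|i r IH] h.
  by under eq_fun do rewrite big_nil; rewrite big_nil; exact: cvg_cst.
under eq_fun do rewrite big_cons; rewrite big_cons.
apply: cvgD; first by apply: h; rewrite inE eqxx.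
by apply: IH => j jr; apply: h; rewrite inE jr orbT.
Qed.

Lemma cvg_prod_seq (T : Type) (F : set_system T) {FF : Filter F} (I : eqType)
    (r : seq I) (u : I -> T -> R) (l : I -> R) :
  (forall i, i \in r -> u i x @[x --> F] --> l i) ->
  \prod_(i <- r) u i x @[x --> F] --> \prod_(i <- r) l i.
Proof.
elim: r => [|i r IH] H.
  by under eq_fun do rewrite big_nil; rewrite big_nil; exact: cvg_cst.
under eq_fun do rewrite big_cons; rewrite big_cons.
apply: cvgM; first by apply: H; rewrite inE eqxx.
by apply: IH => j jr; apply: H; rewrite inE jr orbT.
Qed.

Lemma is_derive_continuous f (x d : R) : is_derive x 1 f d -> {for x, continuous f}.
Proof. by move=> [/derivable1_diffP/differentiable_continuous]. Qed.

Lemma is_derive_within (a b : R) f df :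
  (forall x, a <= x <= b -> is_derive x 1 f (df x)) ->
  {within `[a, b], continuous f}.
Proof.
move=> h; apply: continuous_in_subspaceT => x; rewrite inE/= in_itv/= => xab.
exact: is_derive_continuous (h x xab).
Qed.

Lemma mean_value (a b : R) f df : a < b ->
  (forall x, a <= x <= b -> is_derive x 1 f (df x)) ->
  exists2 c, a < c < b & f b - f a = df c * (b - a).
Proof.
move=> ab h; have [] := @MVT R f df a b ab.
- by move=> x; rewrite in_itv/= => /andP[ax xb]; apply: h; rewrite !ltW.
- exact: is_derive_within h.
- by move=> c; rewrite in_itv/= => cab ?; exists c.
Qed.

Lemma is_derive_sum_seq (I : eqType) (r : seq I) (F dF : I -> R -> R) (x : R) :
  (forall i, i \in r -> is_derive x 1 (F i) (dF i x)) ->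
  is_derive x 1 (fun y => \sum_(i <- r) F i y) (\sum_(i <- r) dF i x).
Proof.
elim: r => [|i r IH] h.
  by under eq_fun do rewrite big_nil; rewrite big_nil; exact: is_derive_cst.
under eq_fun do rewrite big_cons; rewrite big_cons.
apply: is_deriveD; first by apply: h; rewrite inE eqxx.
by apply: IH => j jr; apply: h; rewrite inE jr orbT.
Qed.

Lemma is_derive_comp1 f g (x a b : R) :
  is_derive (g x) 1 f a -> is_derive x 1 g b ->
  is_derive x 1 (fun y => f (g y)) (a * b).
Proof. exact: is_derive1_comp. Qed.

Lemma is_derive_onem (s : R) : is_derive s 1 (fun s : R => 1 - s) (-1).
Proof.
rewrite -[X in is_derive _ _ _ X]add0r.
exact: is_deriveD.
Qed.

(** Tannery's theorem: dominated convergence for series, where the sum of the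
    [n]-th series is given as [T n]. *)
Lemma tannery (u : nat -> nat -> R) (v B T : nat -> R) :
  (\forall n \near \oo, forall k, `|u n k| <= B k) ->
  cvgn (series B) ->
  (forall k, u n k @[n --> \oo] --> v k) ->
  (\forall n \near \oo, series (u n) @ \oo --> T n) ->
  cvgn (series v) /\ T @ \oo --> limn (series v).
Proof.
move=> uB cB uv uT.
have vB k : `|v k| <= B k.
  have h : `|u n k| @[n --> \oo] --> `|v k| by apply: cvg_norm; exact: uv.
  rewrite -(cvg_lim _ h)//; apply: limr_le; first by apply/cvg_ex; eexists; exact: h.
  by near=> n; have uBn : forall i, `|u n i| <= B i by near: n.
have B0 k : 0 <= B k by apply: le_trans (vB k).
have tail (w : nat -> R) (W : R) (N : nat) : (forall k, `|w k| <= B k) -> series w @ \oo --> W ->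
    `|W - series w N| <= limn (series B) - series B N.
  move=> wB wW.
  have h : `|series w n - series w N| @[n --> \oo] --> `|W - series w N|.
    by apply: cvg_norm; apply: cvgB => //; exact: cvg_cst.
  rewrite -(cvg_lim _ h)//; apply: limr_le; first by apply/cvg_ex; eexists; exact: h.
  near=> n; have Nn : (N <= n)%N by near: n; exact: nbhs_infty_ge.
  rewrite sub_series_geq//.
  apply: (@le_trans _ _ (series B n - series B N)).
    rewrite sub_series_geq//; apply: le_trans (ler_norm_sum _ _ _) _.
    by apply: ler_sum => k _.
  rewrite lerD2r; apply: nondecreasing_cvgn_le => //.
  by apply: nondecreasing_series => k _ _; exact: B0.
have cv : cvgn (series v).
  by apply: normed_cvg; apply: (series_le_cvg _ _ _ cB) => [k|k|k] /=.
split => //.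
apply/cvgrPdist_le => e e0.
have e3 : 0 < e / 3 by rewrite divr_gt0.
have [N _ NB] : \forall N \near \oo, limn (series B) - series B N <= e / 3.
  have /cvgrPdist_le/(_ _ e3) := cB.
  by apply: filterS => N; apply: le_trans; exact: ler_norm.
have {}NB := NB N (leqnn N).
have cN : series (u n) N @[n --> \oo] --> series v N.
  by rewrite /series/=; apply: cvg_sum_seq => k _; exact: uv.
move/cvgrPdist_le/(_ _ e3) : cN => cN.
near=> n.
have b1 : `|T n - series (u n) N| <= e / 3.
  by apply: le_trans NB; apply: tail; [near: n|near: n].
have b2 : `|limn (series v) - series v N| <= e / 3 by apply: le_trans NB; exact: tail.
have b3 : `|series v N - series (u n) N| <= e / 3 by near: n.
rewrite (_ : _ - T n = (limn (series v) - series v N) + (series v N - series (u n) N)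
  - (T n - series (u n) N)); last by ring.
apply: le_trans (ler_normB _ _) _.
apply: le_trans (lerD (ler_normD _ _) (lexx _)) _.
lra.
Unshelve. all: by end_near. Qed.

End Calc.

(** * Alternating finite differences *)

Section FiniteDifferences.
Context {R : realType}.
Implicit Types (f g : R -> R) (d x y : R).

(** The [m]-th alternating difference with step [d], that is [(-1) ^ m] times
    the [m]-th forward difference. It is nonnegative for completely monotonic
    [f]. *)
Definition altdiff m d f x : R :=
  \sum_(j < m.+1) (-1) ^+ j * 'C(m, j)%:R * f (x + j%:R * d).

Lemma altdiff0 d f x : altdiff 0 d f x = f x.
Proof. by rewrite /altdiff big_ord1 expr0 bin0 !mul1r mul0r addr0. Qed.

Lemma altdiffS m d f x : altdiff m.+1 d f x = altdiff m d f x - altdiff m d f (x + d).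
Proof.
rewrite /altdiff big_ord_recl/= bin0 expr0 mulr1.
under eq_bigr => i _ do rewrite /bump/= add1n binS natrD.
have -> : \sum_(i < m.+1) (-1) ^+ i.+1 * ('C(m, i.+1)%:R + 'C(m, i)%:R) * f (x + i.+1%:R * d)
  = \sum_(i < m.+1) (-1) ^+ i.+1 * 'C(m, i.+1)%:R * f (x + i.+1%:R * d)
   - \sum_(i < m.+1) (-1) ^+ i * 'C(m, i)%:R * f (x + d + i%:R * d).
  rewrite -sumrB; apply: eq_bigr => i _.
  rewrite exprS (_ : x + d + i%:R * d = x + i.+1%:R * d); first by ring.
  by rewrite -natr1; ring.
rewrite addrA; congr (_ - _).
rewrite [in RHS]big_ord_recl/= bin0 expr0 mulr1; congr (_ + _).
by rewrite big_ord_recr/= bin_small// mulr0 mul0r addr0.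
Qed.

Lemma altdiffZ m d (c : R) f x :
  altdiff m d (fun y => c * f y) x = c * altdiff m d f x.
Proof. by rewrite /altdiff mulr_sumr; apply: eq_bigr => i _; rewrite mulrCA. Qed.

Lemma altdiffSr m d f x :
  altdiff m.+1 d f x = altdiff m d (fun y => f y - f (y + d)) x.
Proof.
rewrite altdiffS /altdiff -sumrB; apply: eq_bigr => i _.
by rewrite -mulrBr [x + d + _]addrAC.
Qed.

(** Mean value theorem for iterated differences, for a family [G] of
    successive derivatives. *)
Lemma altdiff_mean_value m d x (G : nat -> R -> R) : 0 < d ->
  (forall k y, x <= y -> is_derive y 1 (G k) (G k.+1 y)) ->
  exists2 xi, x <= xi <= x + m%:R * d &
    altdiff m d (G 0%N) x = (-1) ^+ m * d ^+ m * G m xi.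
Proof.
move=> d0; elim: m G => [|m IH] G dG.
  by exists x; rewrite ?mul0r ?addr0 ?lexx// altdiff0 !expr0 !mul1r.
have [|xi /andP[x1 x2]] := IH (fun k y => G k y - G k (y + d)).
- move=> k y xy; apply: is_deriveB; first exact: dG.
  have h : is_derive (y + d) 1 (G k) (G k.+1 (y + d)) by apply: dG; lra.
  have hs : is_derive y 1 (fun z : R => z + d) 1.
    by rewrite -[X in is_derive _ _ _ X]addr0; exact: is_deriveD.
  by have := @is_derive_comp1 R (G k) (fun z => z + d) _ _ _ h hs; rewrite mulr1.
- rewrite -altdiffSr => ->.
  have [||c /andP[c1 c2] cE] := @mean_value R xi (xi + d) (G m) (G m.+1).
  + by rewrite ltrDl.
  + by move=> y /andP[y1 y2]; apply: dG; lra.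
  exists c; first by rewrite -natr1; lra.
  rewrite -opprB cE exprS exprSr; ring.
Qed.

Lemma altdiff_inv m y : 0 < y ->
  altdiff m 1 (fun z => z^-1) y = m`!%:R / \prod_(i < m.+1) (y + i%:R).
Proof.
elim: m y => [|m IH] y y0.
  by rewrite altdiff0 big_ord1 addr0 fact0 div1r.
rewrite altdiffS !IH ?addr_gt0//.
have -> : \prod_(i < m.+2) (y + i%:R) = y * \prod_(i < m) (y + 1 + i%:R) * (y + 1 + m%:R).
  rewrite big_ord_recl/= addr0 big_ord_recr/= mulrA; congr (_ * _ * _).
    by apply: eq_bigr => i _; rewrite /bump/= add1n -natr1; ring.
  by rewrite /bump/= add1n -natr1; ring.
have -> : \prod_(i < m.+1) (y + i%:R) = y * \prod_(i < m) (y + 1 + i%:R).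
  rewrite big_ord_recl/= addr0; congr (_ * _).
  by apply: eq_bigr => i _; rewrite /bump/= add1n -natr1; ring.
rewrite big_ord_recr/=.
have P0 : \prod_(i < m) (y + 1 + i%:R) != 0.
  by apply/prodf_neq0 => i _; rewrite gt_eqF// ltr_wpDr// addr_gt0.
have Pm : y + 1 + m%:R != 0 by rewrite gt_eqF// ltr_wpDr// addr_gt0.
rewrite factS natrM -natr1; field.
by rewrite Pm P0 gt_eqF.
Qed.

(** The product of the differences between the [i]-th of [n.+1] equidistant
    nodes and the others; the factor of index [i] is replaced by 1. *)
Lemma prod_equidistant (q : nat -> R) n d i : (forall i, q i = q 0%N + i%:R * d) -> (i <= n)%N ->
  \prod_(j < n.+1) (if j == i :> nat then 1 else q j - q i)
   = (-1) ^+ i * i`!%:R * (n - i)`!%:R * d ^+ n.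
Proof.
move=> qE ni.
rewrite -(big_mkord xpredT (fun j => if j == i then 1 else q j - q i)).
rewrite (big_cat_nat (n := i))//=; last exact: leqW.
rewrite [X in _ * X]big_ltn//= eqxx mul1r.
have -> : \prod_(0 <= j < i) (if j == i then 1 else q j - q i) = (-1) ^+ i * i`!%:R * d ^+ i.
  rewrite big_nat_rev/= add0n fact_prod big_add1/=.
  rewrite natr_prod [LHS](eq_big_nat _ _ (F2 := fun j => - 1 * (j.+1%:R * d))); last first.
    move=> j /andP[_ ji]; rewrite ltn_eqF; last by rewrite subnSK// leq_subr.
    rewrite (qE (i - j.+1)%N) (qE i) natrB//; ring.
  rewrite !big_split/= !prodr_const_nat !subn0; ring.
have -> : \prod_(i.+1 <= j < n.+1) (if j == i then 1 else q j - q i) = (n - i)`!%:R * d ^+ (n - i).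
  rewrite -[i.+1]add1n -[n.+1](@subnK i) ?leqW// big_addn addnK subSn//.
  rewrite fact_prod natr_prod [LHS](eq_big_nat _ _ (F2 := fun j => j%:R * d)); last first.
    move=> j /andP[j0 _]; rewrite gtn_eqF; last by rewrite -[X in (X < _)%N]add0n ltn_add2r.
    by rewrite (qE (j + i)%N) (qE i) natrD; ring.
  by rewrite big_split/= prodr_const_nat subn1.
rewrite -[X in _ = _ * d ^+ X](subnK ni) exprD; ring.
Qed.

End FiniteDifferences.

(** * Absolutely monotone functions *)

Section AbsMon.
Context {R : realType}.
Implicit Types (A B : set R) (f g : R -> R) (L : seq (R * R)).

(** A list [L] of pairs (weight, point) stands for the linear functional
    [g |-> \sum_(z <- L) z.1 * g z.2]; this says that it is nonnegative on all
    monomials. *)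
Definition nonneg_on_powers L : Prop :=
  forall k, 0 <= \sum_(z <- L) z.1 * z.2 ^+ k.

(** Absolute monotonicity on [A], in dual form: [g] is nonnegative under each
    finitely supported functional on [A] which is nonnegative on all
    monomials. Thus [g] lies in the pointwise closure of the convex cone
    generated by the monomials, as do power series with nonnegative
    coefficients; the dual form makes the closure properties below immediate.
    A record, rather than a plain definition, keeps the quantifiers from being
    unfolded by unification. *)
Record absmon A g : Prop := AbsMon { absmonP : forall L,
  (forall z, z \in L -> A z.2) -> nonneg_on_powers L ->
  0 <= \sum_(z <- L) z.1 * g z.2 }.

Lemma absmon_eq A B f g : B `<=` A -> (forall s, B s -> f s = g s) ->
  absmon A f -> absmon B g.
Proof.
move=> BA fg Af; split=> L LB L0; have := absmonP Af (fun z zL => BA _ (LB z zL)) L0.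
by rewrite (eq_big_seq (fun z => z.1 * g z.2))// => z zL; rewrite fg//; exact: LB.
Qed.

Lemma absmon_ext A f g : (forall s, A s -> f s = g s) -> absmon A f -> absmon A g.
Proof. exact: absmon_eq. Qed.

Lemma absmonX A k : absmon A (fun s => s ^+ k).
Proof. by split=> L _; exact. Qed.

Lemma absmonZ A c g : 0 <= c -> absmon A g -> absmon A (fun s => c * g s).
Proof.
move=> c0 Ag; split=> L LA L0.
under eq_bigr do rewrite mulrCA.
by rewrite -mulr_sumr mulr_ge0// (absmonP Ag).
Qed.

Lemma absmon_cst A c : 0 <= c -> absmon A (fun=> c).
Proof.
move=> c0; apply: (@absmon_eq A A (fun s => c * s ^+ 0)) => //.
  by move=> s _; rewrite expr0 mulr1.
by apply: absmonZ => //; exact: absmonX.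
Qed.

Lemma absmonD A f g : absmon A f -> absmon A g -> absmon A (fun s => f s + g s).
Proof.
move=> Af Ag; split=> L LA L0; under eq_bigr do rewrite mulrDr.
by rewrite big_split/= addr_ge0// ?(absmonP Af) ?(absmonP Ag).
Qed.

(** If a functional is nonnegative on monomials, so is its product with a
    monomial, hence with [f], so that it may be evaluated at [g]. *)
Lemma absmonM A f g : absmon A f -> absmon A g -> absmon A (fun s => f s * g s).
Proof.
move=> Af Ag; split=> L LA L0.
have := @absmonP _ _ Ag [seq (z.1 * f z.2, z.2) | z <- L].
rewrite big_map/=; under eq_bigr do rewrite -mulrA.
apply.
  by move=> _ /mapP[z zL ->]/=; exact: LA.
move=> k; rewrite big_map/=; under eq_bigr do rewrite -mulrA (mulrC (f _)) mulrA.
have := @absmonP _ _ Af [seq (z.1 * z.2 ^+ k, z.2) | z <- L].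
rewrite big_map/=; apply.
  by move=> _ /mapP[z zL ->]/=; exact: LA.
move=> j; rewrite big_map/=; under eq_bigr do rewrite -mulrA -exprD.
exact: L0.
Qed.

Lemma absmon_exprn A g n : absmon A g -> absmon A (fun s => g s ^+ n).
Proof.
move=> Ag; elim: n => [|n IH].
  by under eq_fun do rewrite expr0; exact: absmon_cst.
by under eq_fun do rewrite exprS; exact: (absmonM Ag IH).
Qed.

Lemma absmon_sum A n (h : nat -> R -> R) : (forall i, (i < n)%N -> absmon A (h i)) ->
  absmon A (fun s => \sum_(i < n) h i s).
Proof.
elim: n => [|n IH] hn.
  by under eq_fun do rewrite big_ord0; exact: absmon_cst.
under eq_fun do rewrite big_ord_recr/=.
by apply: (absmonD (IH _) (hn _ _)) => // i ni; exact/hn/ltnW.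
Qed.

Lemma absmon_prod A n (h : nat -> R -> R) : (forall i, (i < n)%N -> absmon A (h i)) ->
  absmon A (fun s => \prod_(i < n) h i s).
Proof.
elim: n => [|n IH] hn.
  by under eq_fun do rewrite big_ord0; exact: absmon_cst.
under eq_fun do rewrite big_ord_recr/=.
by apply: (absmonM (IH _) (hn _ _)) => // i ni; exact/hn/ltnW.
Qed.

Lemma absmon_lim A (u : nat -> R -> R) g :
  (forall n, absmon A (u n)) -> (forall s, A s -> u n s @[n --> \oo] --> g s) ->
  absmon A g.
Proof.
move=> Au ug; split=> L LA L0.
have h : \sum_(z <- L) z.1 * u n z.2 @[n --> \oo] --> \sum_(z <- L) z.1 * g z.2.
  by apply: cvg_sum_seq => z zL; apply: cvgM; [exact: cvg_cst|exact/ug/LA].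
rewrite -(cvg_lim _ h)//; apply: limr_ge; first by apply/cvg_ex; eexists; exact: h.
by apply: nearW => n; by have /absmonP := Au n; apply.
Qed.

Lemma absmon_ge0 A g s : absmon A g -> A s -> 0 <= s -> 0 <= g s.
Proof.
move=> Ag As s0; have := @absmonP _ _ Ag [:: (1, s)]; rewrite big_seq1/= mul1r; apply.
  by move=> z; rewrite inE => /eqP ->.
by move=> k; rewrite big_seq1/= mul1r exprn_ge0.
Qed.

(** The divided difference of [s ^ k] at [s0 >= 0] is a polynomial with
    nonnegative coefficients. *)
Lemma absmon_divdiff A B s0 g : B `<=` A -> A s0 -> 0 <= s0 ->
  (forall s, B s -> 0 <= s /\ s != s0) ->
  absmon A g -> absmon B (fun s => (g s - g s0) / (s - s0)).
Proof.
move=> BA As0 s00 B0 Ag; split=> L LB L0.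
have h f : \sum_(z <- [seq (z.1 / (z.2 - s0), z.2) | z <- L] ++
    [seq (- (z.1 / (z.2 - s0)), s0) | z <- L]) z.1 * f z.2 =
  \sum_(z <- L) z.1 * ((f z.2 - f s0) / (z.2 - s0)).
  rewrite big_cat !big_map/= -big_split/=; apply: eq_bigr => z _.
  ring.
rewrite -h; apply: (absmonP Ag).
  by move=> z; rewrite mem_cat => /orP[] /mapP[y yL ->]//=; exact/BA/LB.
move=> k; rewrite (h (fun s => s ^+ k)).
rewrite (eq_big_seq (fun z => \sum_(i < k) s0 ^+ i * (z.1 * z.2 ^+ (k.-1 - i)))); last first.
  move=> z zL; have [_ zs] := B0 _ (LB _ zL).
  rewrite subrXX mulrAC divff ?subr_eq0// mul1r mulr_sumr; apply: eq_bigr => i _.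
  ring.
rewrite exchange_big/=; apply: sumr_ge0 => i _; rewrite -mulr_sumr mulr_ge0//.
by rewrite exprn_ge0.
Qed.

Lemma absmon_geom A C m : 0 < C -> (forall s, A s -> 0 <= m s < C) ->
  absmon A m -> absmon A (fun s => (C - m s)^-1).
Proof.
move=> C0 mC Am.
apply: (@absmon_lim _ (fun n s => \sum_(i < n) C^-1 * (C^-1 * m s) ^+ i)).
  move=> n; apply: (@absmon_sum _ _ (fun i s => C^-1 * (C^-1 * m s) ^+ i)) => i _.
  apply: absmonZ; first by rewrite invr_ge0 ltW.
  by apply: absmon_exprn; apply: absmonZ => //; rewrite invr_ge0 ltW.
move=> s As; have /andP[m0 m1] := mC s As.
have -> : (C - m s)^-1 = C^-1 * (1 - C^-1 * m s)^-1.
  rewrite -invfM; congr (_^-1); rewrite mulrBr mulr1 mulrA divff ?mul1r//.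
  by rewrite gt_eqF.
have := @cvg_geometric_series R C^-1 (C^-1 * m s).
rewrite seriesEord; apply.
rewrite ger0_norm ?mulr_ge0 ?invr_ge0 ?(ltW C0)//.
by rewrite mulrC ltr_pdivrMr// mul1r.
Qed.

Lemma absmon_expR A g : absmon A g -> absmon A (fun s => expR (g s)).
Proof.
move=> Ag.
apply: (@absmon_lim _ (fun n s => \sum_(i < n) (i`!%:R)^-1 * (g s) ^+ i)).
  move=> n; apply: (@absmon_sum _ _ (fun i s => (i`!%:R)^-1 * (g s) ^+ i)) => i _.
  by apply: absmonZ => //; apply: absmon_exprn.
move=> s As; rewrite /expR.
have := @is_cvg_series_exp_coeff R (g s).
rewrite seriesEord/=.
by under eq_fun do under eq_bigr do rewrite /exp_coeff/= mulrC.
Qed.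

End AbsMon.

Section AbsMonPowers.
Context {R : realType}.
Implicit Types (A B : set R) (f g : R -> R) (L : seq (R * R)).

(** For a functional [L], the derivative of [u |-> L (fun s => g (u * s))] is
    nonnegative on the unit interval, and the value at [u = 0] is a
    nonnegative multiple of [g 0]. *)
Lemma absmon_antiderivative g (dg : R -> R) :
  (forall s : R, 0 <= s < 1 -> is_derive s 1 g (dg s)) ->
  absmon [set s : R | 0 <= s < 1] dg -> 0 <= g 0 ->
  absmon [set s : R | 0 <= s < 1] g.
Proof.
move=> hg Adg g0; split=> L LA L0.
(* [phi u] is the functional [L] applied to [s |-> g (u * s)] *)
pose phi u := \sum_(z <- L) z.1 * g (u * z.2).
pose dphi u := \sum_(z <- L) z.1 * (dg (u * z.2) * z.2).
have dphiE (u : R) : 0 <= u <= 1 -> is_derive u 1 phi (dphi u).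
  move=> /andP[u0 u1]; apply: (@is_derive_sum_seq _ _ _ (fun z v => z.1 * g (v * z.2))
    (fun z v => z.1 * (dg (v * z.2) * z.2))) => z /LA /= /andP[z0 z1].
  apply: is_deriveZ; apply: is_derive_comp1.
    apply: hg; rewrite mulr_ge0//=; apply: le_lt_trans z1.
    by rewrite ler_piMl.
  apply: is_derive_eq; rewrite /GRing.scale/=; ring.
have dphi0 (u : R) : 0 <= u <= 1 -> 0 <= dphi u.
  move=> /andP[u0 u1].
  have := absmonP Adg (L := [seq (z.1 * z.2, u * z.2) | z <- L]).
  rewrite big_map/= /dphi.
  rewrite (eq_bigr (fun z => z.1 * (dg (u * z.2) * z.2))); last first.
    by move=> z _; rewrite -mulrA (mulrC z.2).
  apply.
    move=> _ /mapP[z /LA/= /andP[z0 z1] ->] /=; rewrite mulr_ge0//=.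
    by apply: le_lt_trans z1; rewrite ler_piMl.
  move=> k; rewrite big_map/=.
  under eq_bigr do rewrite exprMn mulrCA -mulrA -exprS.
  by rewrite -mulr_sumr mulr_ge0// exprn_ge0.
have phi0 : 0 <= phi 0.
  rewrite /phi; under eq_bigr do rewrite mul0r.
  rewrite -mulr_suml mulr_ge0//; have := L0 0.
  by under eq_bigr do rewrite expr0 mulr1.
have [c /andP[c0 c1]] := mean_value (@ltr01 R) dphiE.
move=> /eqP; rewrite subr0 mulr1 subr_eq => /eqP phi1.
have : 0 <= phi 1 by rewrite phi1 addr_ge0// dphi0// !ltW.
by rewrite /phi; under eq_bigr do rewrite mul1r.
Qed.

(** A single interior point may be added to the domain by continuity: moving the
    mass at [s0] to the right if it is nonnegative and to the left otherwise
    only increases the values of the functional on monomials. *)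
Lemma absmon_continuous_at A g (s0 : R) : 0 < s0 ->
  (\forall s \near s0, A s) -> {for s0, continuous g} ->
  absmon [set s | A s /\ s != s0] g -> absmon A g.
Proof.
move=> s00 nA cg Ag; split=> L LA L0.
(* points other than [s0] are kept; [s0] moves by [e], to the side given by its weight *)
pose sg (z : R * R) e := if z.2 == s0 then (if 0 <= z.1 then s0 + e else s0 - e) else z.2.
have cp : s0 + e @[e --> 0^'+] --> s0.
  rewrite -[X in _ --> X]addr0; apply: cvgD; first exact: cvg_cst.
  exact: cvg_at_right_filter.
have cm : s0 - e @[e --> 0^'+] --> s0.
  rewrite -[X in _ --> X]subr0; apply: cvgB; first exact: cvg_cst.
  exact: cvg_at_right_filter.
have h : \sum_(z <- L) z.1 * g (sg z e) @[e --> 0^'+] --> \sum_(z <- L) z.1 * g z.2.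
  apply: cvg_sum_seq => z zL; apply: cvgM; first exact: cvg_cst.
  rewrite /sg; have [->|_] := eqVneq z.2 s0; last exact: cvg_cst.
  by case: (0 <= z.1); apply: continuous_cvg.
rewrite -(cvg_lim _ h)//; apply: limr_ge; first by apply/cvg_ex; eexists; exact: h.
near=> e.
have e0 : 0 < e by near: e; exact: nbhs_right_gt.
have es0 : e < s0 by near: e; exact: nbhs_right_lt.
have Ap : A (s0 + e) by near: e; exact: (cp _ nA).
have Am : A (s0 - e) by near: e; exact: (cm _ nA).
have := absmonP Ag (L := [seq (z.1, sg z e) | z <- L]); rewrite big_map/=; apply.
  move=> _ /mapP[z zL ->]/=; rewrite /sg; case: ifPn => [_|zs0]; last first.
    by split => //; exact: LA.
  case: ifP => _; split => //; lra.
move=> k; rewrite big_map/=; apply: (le_trans (L0 k)).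
rewrite big_seq_cond [leRHS]big_seq_cond; apply: ler_sum => z; rewrite andbT => zL.
rewrite /sg; have [->|_]// := eqVneq z.2 s0; case: ifPn => [z0|].
  by rewrite ler_wpM2l// lerXn2r ?nnegrE// ?ltW//; lra.
rewrite -ltNge => z0; rewrite ler_nM2l// lerXn2r ?nnegrE//; lra.
Unshelve. all: by end_near. Qed.

Lemma is_derive_powR_onem (a s : R) : s < 1 ->
  is_derive s 1 (fun s => (1 - s) `^ a) (- a * (1 - s) `^ (a - 1)).
Proof.
move=> s1; have s1' : 0 < 1 - s by rewrite subr_gt0.
have h := is_derive1_powR a s1'.
have := @is_derive_comp1 R (fun y : R => y `^ a) (fun s => 1 - s) s _ (-1) h (is_derive_onem s).
by rewrite mulrN1 mulNr.
Qed.

Lemma absmon_onem_powRN (c : R) : 0 <= c ->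
  absmon [set s : R | 0 <= s < 1] (fun s => (1 - s) `^ (- c)).
Proof.
move=> c0.
apply: (@absmon_ext _ _ (fun s => expR (c * - ln (1 - s)))) => //.
  move=> s /= /andP[_ s1]; rewrite /powR subr_eq0 eq_sym lt_eqF//.
  by rewrite mulrN mulNr.
apply: absmon_expR; apply: absmonZ => //.
apply: (@absmon_antiderivative _ (fun s => (1 - s)^-1)).
- move=> s /andP[s0 s1]; have s1' : 0 < 1 - s by rewrite subr_gt0.
  have h := is_derive1_ln s1'.
  rewrite -[_^-1]opprK; apply: is_deriveN.
  have := @is_derive_comp1 R (@ln R) (fun s => 1 - s) s _ (-1) h (is_derive_onem s).
  by rewrite mulrN1.
- apply: absmon_geom => //.
  by apply: absmon_eq (absmonX [set s : R | 0 <= s < 1] 1) => // s _; rewrite expr1.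
- by rewrite subr0 ln1 oppr0.
Qed.

(** The only place where [b <= 2] matters: the second derivative is a
    nonnegative multiple of [(1 - s) `^ (- (2 - b))]. *)
Lemma absmon_onem_powR (b : R) : 1 <= b <= 2 ->
  absmon [set s : R | 0 <= s < 1] (fun s => (1 - s) `^ b - 1 + b * s).
Proof.
move=> /andP[b1 b2].
apply: (@absmon_antiderivative _ (fun s => b * (1 - (1 - s) `^ (b - 1)))).
- move=> s /andP[_ s1]; have h := is_derive_powR_onem b s1.
  apply: is_derive_eq; rewrite /GRing.scale/=; ring.
- apply: absmonZ; first by rewrite (le_trans ler01).
  apply: (@absmon_antiderivative _ (fun s => (b - 1) * (1 - s) `^ (- (2 - b)))).
  + move=> s /andP[_ s1]; have h := is_derive_powR_onem (b - 1) s1.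
    apply: is_derive_eq; (have -> : b - 1 - 1 = - (2 - b) by ring); ring.
  + apply: absmonZ; first by rewrite subr_ge0.
    by apply: absmon_onem_powRN; rewrite subr_ge0.
  + by rewrite subr0 powR1 subrr.
- by rewrite subr0 powR1 subrr add0r mulr0.
Qed.

End AbsMonPowers.

(** * Divided differences and the resolvent of a power *)

Section Resolvent.
Context {R : realType}.
Implicit Types (A B : set R) (f g : R -> R) (b h p q s x y : R).

(** The slope of [y `^ b] between [p] and [y], extended by the derivative at
    [y = p]. *)
Definition powR_slope b p y : R :=
  if y == p then b * p `^ (b - 1) else (p `^ b - y `^ b) / (p - y).

Lemma powR_slopeE b p y : y != p -> powR_slope b p y * (p - y) = p `^ b - y `^ b.
Proof. by move=> yp; rewrite /powR_slope (negbTE yp) divfK// subr_eq0 eq_sym. Qed.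

Lemma ltr_powR b x y : 0 < b -> 0 <= x -> x < y -> x `^ b < y `^ b.
Proof.
by move=> b0 x0 xy; apply: gt0_ltr_powR; rewrite // nnegrE// ltW// (le_lt_trans x0).
Qed.

Lemma powR_slope_gt0 b p y : 0 < b -> 0 < p -> 0 <= y -> 0 < powR_slope b p y.
Proof.
move=> b0 p0 y0; rewrite /powR_slope.
have [yp|py|_] := ltgtP y p.
- by rewrite divr_gt0 ?subr_gt0// ltr_powR.
- by rewrite -mulrNN -invrN !opprB divr_gt0 ?subr_gt0// ltr_powR// ltW.
- by rewrite mulr_gt0// powR_gt0.
Qed.

Lemma continuous_powR_slope b p : 0 < p -> {for p, continuous (powR_slope b p)}.
Proof.
move=> p0; have /is_derive1_caratheodory[k [kE ck kp]] := is_derive1_powR b p0.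
suff -> : powR_slope b p = k by [].
apply/funext => y; rewrite /powR_slope; case: eqVneq => [->//|yp].
apply: (@mulIf _ (y - p)); first by rewrite subr_eq0.
by rewrite -kE -(opprB y p) -(opprB (y `^ b)) invrN mulrNN divfK// subr_eq0.
Qed.

(** The slope is [b] minus a divided difference of an absolutely monotone
    function, and its inverse is a geometric series. *)
Lemma absmon_powR_slopeV b p : 1 <= b <= 2 -> 0 < p < 1 ->
  absmon [set s : R | 0 < s < 1] (fun s => (powR_slope b p (1 - s))^-1).
Proof.
move=> b12 /andP[p0 p1]; have b0 : 0 < b by case/andP: b12 => + _; exact: lt_le_trans.
pose s0 := 1 - p.
have s00 : 0 < s0 by rewrite subr_gt0.
have ps0 : 1 - s0 = p by rewrite /s0; ring.
apply: (@absmon_continuous_at _ _ _ s0) => //.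
- apply: (@near_in_itvoo R 0 1); rewrite in_itv/= s00/=; rewrite /s0; lra.
- have sl0 : powR_slope b p (1 - s0) != 0 by rewrite gt_eqF// powR_slope_gt0// ps0 ltW.
  apply: (@continuousV _ _ (fun s => powR_slope b p (1 - s))) => //.
  apply: (@continuous_comp _ _ _ (fun s => 1 - s) (powR_slope b p)).
    by apply: continuousB; [exact: cvg_cst|exact: cvg_id].
  by rewrite ps0; exact: continuous_powR_slope.
pose g s := (1 - s) `^ b - 1 + b * s.
have Ag : absmon [set s : R | 0 <= s < 1] g by exact: absmon_onem_powR.
have Am : absmon [set s : R | 0 < s < 1 /\ s != s0] (fun s => (g s - g s0) / (s - s0)).
  apply: (absmon_divdiff _ _ _ _ Ag) => //.
  - by move=> s [/andP[sp sl] _] /=; rewrite ltW.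
  - by rewrite /= (ltW s00)/= /s0; lra.
  - exact: ltW.
  - by move=> s [/andP[/ltW]].
have slE s : s != s0 -> powR_slope b p (1 - s) = b - (g s - g s0) / (s - s0).
  move=> ss0; have ss0' : s - s0 != 0 by rewrite subr_eq0.
  rewrite /powR_slope ifF; last first.
    by apply: contra_neqF ss0 => /eqP ps; rewrite /s0 -ps; ring.
  apply: (@mulIf _ (s - s0)) => //.
  rewrite (_ : p - (1 - s) = s - s0); last by rewrite /s0; ring.
  by rewrite divfK// [RHS]mulrBl divfK// /g ps0; ring.
apply: (@absmon_ext _ _ (fun s => (b - (g s - g s0) / (s - s0))^-1)).
  by move=> s [_ ss0]; rewrite slE.
apply: absmon_geom => // s [/andP[s0' s1] ss0].
rewrite (absmon_ge0 Am) ?ltW//=; last by rewrite s0' s1.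
rewrite -subr_gt0 -slE//; apply: powR_slope_gt0 => //; lra.
Qed.

Lemma powR_slope_scale b p y h : 0 < h -> 0 < p -> 0 <= y ->
  powR_slope b p y = h `^ (1 - b) * powR_slope b (h * p) (h * y).
Proof.
move=> h0 p0 y0; have hn0 : h != 0 by rewrite gt_eqF.
have hb1 : h `^ (1 - b) = (h `^ (b - 1))^-1 by rewrite -powRN opprB.
have hbE : h `^ b = h * h `^ (b - 1).
  rewrite -[X in X * _](powRr1 (ltW h0)) -powRD ?hn0 ?implybT//.
  by congr (_ `^ _); ring.
have hb : h `^ (b - 1) != 0 by rewrite gt_eqF// powR_gt0.
rewrite /powR_slope (inj_eq (mulfI hn0)) hb1; case: eqVneq => [_|yp].
  by rewrite powRM ?ltW//; field.
rewrite !powRM ?(ltW h0) ?(ltW p0)// hbE.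
have yp' : p - y != 0 by rewrite subr_eq0 eq_sym.
by field; rewrite hb yp' -mulrBr mulf_neq0.
Qed.

Lemma absmon_powR_slopeV_scale b p h : 1 <= b <= 2 -> 0 < h -> 0 < p -> h * p < 1 ->
  absmon [set s : R | 0 < s < 1] (fun s => (powR_slope b p ((1 - s) / h))^-1).
Proof.
move=> b12 h0 p0 hp1.
apply: (@absmon_ext _ _
  (fun s => (h `^ (1 - b))^-1 * (powR_slope b (h * p) (1 - s))^-1)).
  move=> s /andP[_ s1].
  rewrite (powR_slope_scale _ h0 p0); last by rewrite divr_ge0 ?subr_ge0 ?ltW.
  by rewrite invfM [h * (_ / _)]mulrC divfK// gt_eqF.
apply: absmonZ; first by rewrite invr_ge0 powR_ge0.
by apply: absmon_powR_slopeV => //; rewrite mulr_gt0.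
Qed.

(** The iterated divided difference of [f] at the nodes [t 0, ..., t n.-1]. *)
Fixpoint divdiff (t : nat -> R) n f : R -> R :=
  if n is n'.+1 then
    fun s => (divdiff t n' f s - divdiff t n' f (t n')) / (s - t n')
  else f.

Lemma absmon_divdiffs A (t : nat -> R) n f : (forall i j, (i < j < n)%N -> t i != t j) ->
  (forall i, (i < n)%N -> A (t i)) -> (forall s, A s -> 0 <= s) ->
  absmon A f ->
  absmon [set s | A s /\ forall i, (i < n)%N -> s != t i] (divdiff t n f).
Proof.
move=> + + A0 Af; elim: n => [_ _|n IH tinj tA] /=.
  by apply: absmon_eq Af => // s [].
have {}IH : absmon [set s | A s /\ forall i, (i < n)%N -> s != t i] (divdiff t n f).
  apply: IH; last by move=> i ni; exact/tA/ltnW.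
  by move=> i j /andP[ij jn]; apply: tinj; rewrite ij ltnW.
apply: (absmon_divdiff _ _ _ _ IH).
- by move=> s [As h]; split => // i ni; apply: h; exact: ltnW.
- split; first exact: tA.
  by move=> i ni; rewrite eq_sym; apply: tinj; rewrite ni/=.
- exact/A0/tA.
- by move=> s [As h]; split; [exact: A0|exact: h].
Qed.

(** Newton's form of the divided differences. In the inner product, the factor
    of index [i] holds the difference [s - t i] in place of [t i - t i]. *)
Lemma divdiffE (t : nat -> R) n f s : (forall i j, (i < j < n)%N -> t i != t j) ->
  (forall i, (i < n)%N -> s != t i) ->
  divdiff t n f s = (\prod_(i < n) (s - t i)^-1) * f s -
    \sum_(i < n) f (t i) *
      \prod_(j < n) (if j == i :> nat then s - t i else t i - t j)^-1.
Proof.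
elim: n s => [|n IH] s tinj st; first by rewrite !big_ord0 mul1r subr0.
have tinj' i j : (i < j < n)%N -> t i != t j.
  by move=> /andP[ij jn]; apply: tinj; rewrite ij ltnW.
have tn i : (i < n)%N -> t n != t i.
  by move=> ni; rewrite eq_sym; apply: tinj; rewrite ni/=.
have sn : s - t n != 0 by rewrite subr_eq0 st.
rewrite /= (IH s)// ?(IH (t n))//; last by move=> i ni; apply: st; exact: ltnW.
(* [c s i] is the term of index [i] at [s]; [c (t n) i], the one at the new node *)
pose c x i := f (t i) * \prod_(j < n) (if j == i :> nat then x - t i else t i - t j)^-1.
have cE (i : 'I_n) : f (t i) *
    \prod_(j < n.+1) (if j == i :> nat then s - t i else t i - t j)^-1 =
    (c s i - c (t n) i) / (s - t n).
  rewrite /c -mulrBr -mulrA; congr (_ * _).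
  rewrite big_ord_recr/= gtn_eqF//.
  rewrite (bigD1 i)//= [X in _ = (_ - X) / _](bigD1 i)//= !eqxx.
  have nji (x : R) : \prod_(j < n | j != i) (if j == i :> nat then x else t i - t j)^-1 =
      \prod_(j < n | j != i) (t i - t j)^-1.
    by apply: eq_bigr => j ji; rewrite -(inj_eq val_inj) in ji; rewrite (negbTE ji).
  rewrite !nji.
  have := tn _ (ltn_ord i); have := st i (ltnW (ltn_ord i)).
  rewrite -subr_eq0 => s1; rewrite -subr_eq0 => s2.
  by field; rewrite sn s1 s2 -opprB oppr_eq0 s2.
rewrite [X in _ = _ - X]big_ord_recr/= (eq_bigr _ (fun i _ => cE i)) -mulr_suml sumrB.
rewrite !big_ord_recr/= eqxx.
have -> : \prod_(j < n) (if j == n :> nat then s - t n else t n - t j)^-1 =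
    \prod_(j < n) (t n - t j)^-1.
  by apply: eq_bigr => j _; rewrite ltn_eqF.
by rewrite /c; field.
Qed.

End Resolvent.

Section Kernel.
Context {R : realType}.
Implicit Types (A B : set R) (f g : R -> R) (b h q s x y z : R) (p : nat -> R).

(** The product of the resolvents [1 / (p i `^ b - x `^ b)], [i < n], minus
    its polar part at the simple poles [x = p i]. In the inner product, the
    factor of index [i] is replaced by 1. *)
Definition resolvent_part b p n x : R :=
  \prod_(i < n) (p i `^ b - x `^ b)^-1 -
  \sum_(i < n) (b * p i `^ (b - 1) * (p i - x))^-1 *
    \prod_(j < n) (if j == i :> nat then 1 else p j `^ b - p i `^ b)^-1.

(** Up to the factor [h ^+ n], the resolvent part is the divided difference at
    the nodes [1 - h * p i] of the product of the inverse slopes. *)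
Lemma absmon_resolvent_part b p n h : 1 <= b <= 2 -> 0 < h ->
  (forall i, (i < n)%N -> 0 < p i /\ h * p i < 1) ->
  (forall i j, (i < j < n)%N -> p i != p j) ->
  absmon [set s | 0 < s < 1 /\ forall i, (i < n)%N -> s != 1 - h * p i]
    (fun s => resolvent_part b p n ((1 - s) / h)).
Proof.
move=> b12 h0 p0 pinj; have hn0 : h != 0 by rewrite gt_eqF.
have bgt0 : 0 < b by case/andP: b12 => + _; exact: lt_le_trans.
have b0 : b != 0 by rewrite gt_eqF.
pose t i := 1 - h * p i.
pose B s := \prod_(j < n) (powR_slope b (p j) ((1 - s) / h))^-1.
have AB : absmon [set s : R | 0 < s < 1] B.
  apply: (@absmon_prod _ _ _ (fun j s => (powR_slope b (p j) ((1 - s) / h))^-1)) => j jn.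
  by have [pj0 pj1] := p0 j jn; exact: absmon_powR_slopeV_scale.
apply: (@absmon_ext _ _ (fun s => h ^+ n * divdiff t n B s)); last first.
  apply: absmonZ; first by rewrite exprn_ge0// ltW.
  apply: (absmon_divdiffs _ _ _ AB).
  - move=> i j ij; rewrite /t (inj_eq (addrI _)) (inj_eq oppr_inj) (inj_eq (mulfI hn0)).
    exact: pinj.
  - move=> i ni; have [pi0 pi1] := p0 i ni; rewrite /= /t.
    have : 0 < h * p i by rewrite mulr_gt0.
    lra.
  - by move=> s /andP[/ltW].
move=> s [/andP[s0 s1] st].
set x := (1 - s) / h.
have xp i : (i < n)%N -> x != p i.
  move=> ni; apply: contra_neq (st i ni) => <-; rewrite /x mulrC divfK//; ring.
have sti i : s - t i = h * (p i - x).
  by rewrite /t /x mulrBr [h * (_ / _)]mulrC divfK//; ring.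
have tij i j : t i - t j = h * (p j - p i) by rewrite /t; ring.
rewrite divdiffE//; last first.
  move=> i j ij; rewrite /t (inj_eq (addrI _)) (inj_eq oppr_inj) (inj_eq (mulfI hn0)).
  exact: pinj.
have hn : h ^+ n = \prod_(i < n) h by rewrite prodr_const card_ord.
rewrite mulrBr /resolvent_part; congr (_ - _).
  rewrite hn /B -!big_split/=; apply: eq_bigr => i _.
  rewrite -/x sti -(powR_slopeE b (xp i (ltn_ord i))) !invfM.
  by rewrite mulrA mulVKf ?mulrA// mulrC.
rewrite mulr_sumr; apply: eq_bigr => i _.
have pij (j : 'I_n) : j != i -> p i != p j.
  rewrite -(inj_eq val_inj)/= neq_ltn => /orP[ji|ij].
    by rewrite eq_sym pinj// ji ltn_ord.
  by rewrite pinj// ij ltn_ord.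
rewrite hn /B -!big_split/= (bigD1 i)//= [in RHS](bigD1 i)//= !eqxx invr1 mul1r.
have -> : (1 - t i) / h = p i by rewrite /t opprB addrCA subrr addr0 mulrC mulKf.
rewrite {1}/powR_slope eqxx; congr (_ * _).
  rewrite sti; field.
  have [pi0 _] := p0 i (ltn_ord i).
  by rewrite subr_eq0 eq_sym xp//= gt_eqF ?powR_gt0//= b0.
apply: eq_bigr => j ji'; have ji := ji'; rewrite -(inj_eq val_inj)/= in ji.
rewrite (negbTE ji).
have pijr : p j - p i != 0 by rewrite subr_eq0 eq_sym pij.
have sl0 : powR_slope b (p j) (p i) != 0.
  have [pi0 _] := p0 i (ltn_ord i); have [pj0 _] := p0 j (ltn_ord j).
  by rewrite gt_eqF// powR_slope_gt0// ltW.
by rewrite tij -(powR_slopeE b (pij j ji')); field; rewrite hn0 sl0 pijr.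
Qed.

Lemma cvg_resolvent_part (T : Type) (F : set_system T) {FF : Filter F} b p n
    (X : T -> R) z : 0 < b -> 0 < z ->
  (forall i, (i < n)%N -> z < p i) ->
  X t @[t --> F] --> z ->
  resolvent_part b p n (X t) @[t --> F] --> resolvent_part b p n z.
Proof.
move=> b0 z0 zp Xz; rewrite /resolvent_part.
have cb : X t `^ b @[t --> F] --> z `^ b.
  have cz := is_derive_continuous (is_derive1_powR b z0).
  exact: (@continuous_cvg _ _ _ _ _ X (fun y : R => y `^ b) z cz Xz).
apply: cvgB.
  apply: cvg_prod_seq => i _; apply: cvgV.
    rewrite subr_eq0 gt_eqF//; apply: ltr_powR => //; [exact: ltW|exact: zp].
  by apply: cvgB => //; exact: cvg_cst.
apply: cvg_sum_seq => i _; apply: cvgM; last exact: cvg_cst.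
have zpi := zp i (ltn_ord i); have pi0 := lt_trans z0 zpi.
apply: cvgV.
  by rewrite !mulf_neq0 ?gt_eqF ?powR_gt0// subr_gt0.
by apply: cvgM; [exact: cvg_cst|apply: cvgB => //; exact: cvg_cst].
Qed.

Lemma cvg_onem_expRN z : 0 < z ->
  (1 - expR (- (h * z))) / h @[h --> 0^'+] --> z.
Proof.
move=> z0.
have c1 : z / (1 + h * z) @[h --> 0^'+] --> z.
  rewrite -[X in _ --> X]divr1; apply: cvgM; first exact: cvg_cst.
  apply: cvgV => //; rewrite -[X in _ --> X]addr0; apply: cvgD; first exact: cvg_cst.
  rewrite -[X in _ --> X](mul0r z); apply: cvgM; last exact: cvg_cst.
  exact: cvg_at_right_filter.
apply: (squeeze_cvgr _ c1 (cvg_cst _)).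
near=> h.
have h0 : 0 < h by near: h; exact: nbhs_right_gt.
have hz : 0 < h * z by rewrite mulr_gt0.
apply/andP; split.
  have hz1 : 1 + h * z != 0 by rewrite gt_eqF ?addr_gt0.
  rewrite ler_pdivlMr// expRN (_ : z / _ * h = 1 - (1 + h * z)^-1); last by field.
  by rewrite lerD2l lerN2 lef_pV2 ?posrE ?expR_gt0 ?addr_gt0// expR_ge1Dx.
rewrite ler_pdivrMr// (mulrC z).
have := expR_ge1Dx (- (h * z)); lra.
Unshelve. all: by end_near. Qed.

(** The points [s = exp (- h (x + j d))], weighted by signed binomial
    coefficients, form a functional which is nonnegative on monomials; then
    [h] tends to 0. *)
Lemma altdiff_resolvent_part_ge0 b p n m d x : 1 <= b <= 2 ->
  (forall i j, (i < j < n)%N -> p i != p j) ->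
  0 < x -> 0 < d -> (forall i, (i < n)%N -> x + m%:R * d < p i) ->
  0 <= altdiff m d (resolvent_part b p n) x.
Proof.
move=> b12 pinj x0 d0 xp.
have b0 : 0 < b by case/andP: b12 => + _; exact: lt_le_trans.
pose z (j : nat) := x + j%:R * d.
have z0 j : 0 < z j by rewrite /z ltr_wpDr// mulr_ge0// ltW.
have zp i j : (j < m.+1)%N -> (i < n)%N -> z j < p i.
  move=> jm ni; apply: le_lt_trans (xp i ni).
  by rewrite lerD2l ler_wpM2r ?(ltW d0)// ler_nat.
have p0 i : (i < n)%N -> 0 < p i by move=> /(zp i 0 isT); exact: lt_trans.
pose X h j := (1 - expR (- (h * z j))) / h.
have c : \sum_(j < m.+1) (-1) ^+ j * 'C(m, j)%:R * resolvent_part b p n (X h j)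
    @[h --> 0^'+] --> altdiff m d (resolvent_part b p n) x.
  apply: cvg_sum_seq => j _; apply: cvgM; first exact: cvg_cst.
  apply: cvg_resolvent_part => //.
  - exact: z0.
  - by move=> i ni; exact: zp.
  - exact: cvg_onem_expRN.
rewrite -(cvg_lim _ c)//; apply: limr_ge; first by apply/cvg_ex; eexists; exact: c.
(* a common upper bound of the [p i], so that [h * p i < 1] for small [h] *)
pose S := 1 + \sum_(i < n) p i.
have S0 : 0 < S.
  rewrite ltr_pwDl// sumr_ge0// => i _; exact/ltW/p0.
near=> h.
have h0 : 0 < h by near: h; exact: nbhs_right_gt.
have hn0 : h != 0 by rewrite gt_eqF.
have hS : h < S^-1 by near: h; apply: nbhs_right_lt; rewrite invr_gt0.
have hp i : (i < n)%N -> 0 < p i /\ h * p i < 1.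
  move=> ni; split; first exact: p0.
  rewrite -ltr_pdivlMl// mulr1 (lt_le_trans _ (ltW _ : S <= h^-1))//; last first.
    by rewrite -[S]invrK ltf_pV2// posrE// invr_gt0.
  rewrite /S (bigD1 (Ordinal ni))//= addrCA ltrDl ltr_pwDl//.
  by rewrite sumr_ge0// => k _; exact/ltW/p0.
have AM := absmon_resolvent_part b12 h0 hp pinj.
pose L : seq (R * R) :=
  [seq ((-1) ^+ j * 'C(m, j)%:R, expR (- (h * z j))) | j <- index_iota 0 m.+1].
have LE f : \sum_(w <- L) w.1 * f w.2 =
    \sum_(j < m.+1) (-1) ^+ j * 'C(m, j)%:R * f (expR (- (h * z j))).
  by rewrite big_map big_mkord.
have := absmonP AM (L := L); rewrite (LE (fun s => resolvent_part b p n ((1 - s) / h))); apply.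
  move=> _ /mapP[j + ->] /=; rewrite mem_index_iota => /andP[_ jm]; split.
    by rewrite expR_gt0 expR_lt1 oppr_lt0 mulr_gt0.
  move=> i ni; rewrite -subr_eq0 gt_eqF// subr_gt0.
  rewrite (lt_le_trans _ (expR_ge1Dx _))// ltrD2l ltrN2 ltr_pM2l//.
  exact: zp.
move=> k; rewrite (LE (fun s => s ^+ k)).
have -> : \sum_(i < m.+1) (-1) ^+ i * 'C(m, i)%:R * expR (- (h * z i)) ^+ k =
  expR (- (h * x)) ^+ k * (1 - expR (- (h * d)) ^+ k) ^+ m.
  rewrite exprBn mulr_sumr; apply: eq_bigr => i _.
  rewrite expr1n mulr1 -mulr_natr /z.
  have -> : - (h * (x + i%:R * d)) = - (h * x) + i%:R * - (h * d) by ring.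
  rewrite expRD expRM_natl exprMn -!exprM (mulnC k i); ring.
rewrite mulr_ge0 ?exprn_ge0 ?expR_ge0// subr_ge0 exprn_ile1 ?expR_ge0//.
by rewrite expR_le1 oppr_le0 mulr_ge0// ltW.
Unshelve. all: by end_near. Qed.

End Kernel.

(** * Beta integrals converging to the Gamma function *)

Section Limits.
Context {R : realType}.
Implicit Types (s t x y z : R).
Local Notation mu := (@lebesgue_measure R).

Lemma cvg_natV_onem z : (1 - z / n.+1%:R)^-1 @[n --> \oo] --> (1 : R).
Proof.
have h : n.+1%:R^-1 @[n --> \oo] --> (0 : R) by exact: cvg_harmonic.
rewrite -[X in _ --> X]invr1; apply: cvgV => //.
rewrite -[X in _ --> X]subr0; apply: cvgB; first exact: cvg_cst.
by rewrite -[X in _ --> X](mulr0 z); apply: cvgM => //; exact: cvg_cst.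
Qed.

Lemma near_ltr_natS z : \forall n \near \oo, z < n.+1%:R.
Proof.
by apply: filterS (nbhs_infty_gtr z) => n /lt_le_trans; apply; rewrite ler_nat.
Qed.

(** Since [1 + u <= expR u], the product lies between [expR (z M / (M + 1))]
    and [expR (z M / (M - z))], where [M = n.+1]. *)
Lemma cvg_prod_expR (q : nat -> nat -> R) z : 0 <= z ->
  (forall n i, (i <= n)%N -> n.+1%:R <= q n i <= n.+1%:R + 1) ->
  \prod_(i < n.+1) (1 - z / q n i)^-1 @[n --> \oo] --> expR z.
Proof.
move=> z0 qn.
have c1 : expR (z * (1 - -1 / n.+1%:R)^-1) @[n --> \oo] --> expR z.
  apply: continuous_cvg; first exact: continuous_expR.
  rewrite -[X in _ --> X]mulr1; apply: cvgM; first exact: cvg_cst.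
  exact: cvg_natV_onem.
have c2 : expR (z * (1 - z / n.+1%:R)^-1) @[n --> \oo] --> expR z.
  apply: continuous_cvg; first exact: continuous_expR.
  rewrite -[X in _ --> X]mulr1; apply: cvgM; first exact: cvg_cst.
  exact: cvg_natV_onem.
apply: (squeeze_cvgr _ c1 c2); near=> n.
have zn : z < n.+1%:R.
  by near: n; exact: near_ltr_natS.
have n0 : 0 < n.+1%:R :> R by [].
have powE y : expR (z * (1 - y / n.+1%:R)^-1) =
    \prod_(i < n.+1) expR (z * (n.+1%:R - y)^-1).
  rewrite prodr_const card_ord -expRM_natl; congr expR.
  rewrite mulrCA; congr (_ * _).
  by rewrite -[X in X / (_ - _)]invrK -invfM mulrBr mulVf// [_^-1 * _]mulrC.
rewrite !powE; apply/andP; split; apply: ler_prod => i _.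
  rewrite expR_ge0/=.
  have /andP[q1 q2] := qn n i (ltn_ord i).
  have q0 : 0 < q n i by apply: lt_le_trans q1.
  have zq : 0 < 1 - z / q n i by rewrite subr_gt0 ltr_pdivrMr// mul1r (lt_le_trans zn).
  rewrite -[X in X <= _]invrK lef_pV2 ?posrE ?invr_gt0 ?expR_gt0// -expRN.
  apply: le_trans (expR_ge1Dx _); rewrite lerD2l lerN2 ler_wpM2l//.
  by rewrite opprK lef_pV2// posrE addr_gt0.
have /andP[q1 q2] := qn n i (ltn_ord i).
have q0 : 0 < q n i by apply: lt_le_trans q1.
have zq : 0 < 1 - z / q n i by rewrite subr_gt0 ltr_pdivrMr// mul1r (lt_le_trans zn).
rewrite invr_ge0 ltW//=; apply: le_trans (expR_ge1Dx _).
have qz : 0 < q n i - z by rewrite subr_gt0 (lt_le_trans zn).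
have -> : (1 - z / q n i)^-1 = 1 + z / (q n i - z).
  by field; rewrite !gt_eqF.
by rewrite lerD2l ler_wpM2l// lef_pV2 ?posrE// ?subr_gt0// lerD2r.
Unshelve. all: by end_near. Qed.

Lemma cvg_onem_exprn t : 0 <= t -> (1 - t / n.+1%:R) ^+ n.+1 @[n --> \oo] --> expR (- t).
Proof.
move=> t0; rewrite expRN.
have -> : (fun n => (1 - t / n.+1%:R) ^+ n.+1) =
    (fun n => (\prod_(i < n.+1) (1 - t / n.+1%:R)^-1)^-1).
  by apply/funext => n; rewrite prodr_const card_ord exprVn invrK.
apply: cvgV; first by rewrite gt_eqF// expR_gt0.
apply: (@cvg_prod_expR (fun n _ => n.+1%:R)) => // n i _.
by rewrite lexx/= lerDl.
Qed.

(** The value of the integral of [t `^ s * (1 - t / M) ^+ M] for [t] from 0 to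
    [M]. *)
Definition beta_value s M : R :=
  M`!%:R * M%:R `^ (s + 1) / \prod_(i < M.+1) (s + 1 + i%:R).

Lemma cvg_powR_right0 s : 0 <= s -> t `^ s @[t --> 0^'+] --> (0 : R) `^ s.
Proof.
rewrite le_eqVlt => /predU1P[<-|s0].
  by under eq_fun do rewrite powRr0; rewrite powRr0; exact: cvg_cst.
by rewrite powR0 ?gt_eqF//; exact: powR_cvg0.
Qed.

Lemma cvg_powR_at s t : 0 < t -> y `^ s @[y --> t] --> t `^ s.
Proof. by move=> t0; exact: is_derive_continuous (is_derive1_powR s t0). Qed.

(** The binomial expansion is integrated termwise; the resulting alternating
    sum is an iterated difference of the inverse function ([altdiff_inv]). *)
Lemma integral_beta s M : 0 <= s -> (0 < M)%N ->
  (\int[mu]_(t in `[0%R, (M%:R : R)]) (t `^ s * (1 - t / M%:R) ^+ M)%:E = (beta_value s M)%:E)%E.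
Proof.
move=> s0 M0; have M0' : 0 < M%:R :> R by rewrite ltr0n.
have Mn0 : M%:R != 0 :> R by rewrite gt_eqF.
pose c j : R := (-1) ^+ j * 'C(M, j)%:R * M%:R ^- j.
have a0 j : 0 < s + j.+1%:R by rewrite ltr_wpDl.
(* the termwise antiderivative of the binomial expansion *)
pose F t := \sum_(j < M.+1) c j / (s + j.+1%:R) * t `^ (s + j.+1%:R).
pose f t := t `^ s * (1 - t / M%:R) ^+ M.
have dF t : 0 < t -> is_derive t 1 F (f t).
  move=> t0.
  have tn0 : t != 0 by rewrite gt_eqF.
  have -> : f t = \sum_(j < M.+1) c j / (s + j.+1%:R) * ((s + j.+1%:R) * t `^ (s + j.+1%:R - 1)).
    rewrite /f exprBn mulr_sumr; apply: eq_bigr => j _.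
    have -> : s + j.+1%:R - 1 = s + j%:R by rewrite -natr1; ring.
    rewrite [t `^ (s + _)]powRD ?tn0 ?implybT// (powR_mulrn _ (ltW t0)) expr1n
      exprMn exprVn -mulr_natr /c.
    by field; rewrite expf_neq0//= gt_eqF// ltr_wpDl// ltr_pwDl.
  rewrite /F.
  apply: (@is_derive_sum_seq R _ (index_enum 'I_M.+1)
    (fun (j : 'I_M.+1) t => c j / (s + j.+1%:R) * t `^ (s + j.+1%:R))
    (fun (j : 'I_M.+1) t => c j / (s + j.+1%:R) * ((s + j.+1%:R) * t `^ (s + j.+1%:R - 1)))).
  by move=> j _; apply: is_deriveZ; exact: is_derive1_powR.
have cF0 : F t @[t --> 0^'+] --> F 0.
  apply: cvg_sum_seq => j _; apply: cvgM; first exact: cvg_cst.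
  by apply: cvg_powR_right0; exact: ltW.
have F0 : F 0 = 0.
  by rewrite /F big1// => j _; rewrite powR0 ?mulr0// gt_eqF.
have FM : F M%:R = beta_value s M.
  rewrite /beta_value mulrAC -altdiff_inv ?ltr_wpDl// /altdiff mulr_suml.
  apply: eq_bigr => j _; rewrite /c.
  have -> : s + j.+1%:R = s + 1 + j%:R by rewrite -natr1; ring.
  rewrite mulr1 [M%:R `^ (s + 1 + _)]powRD ?Mn0 ?implybT// powR_mulrn//.
  by field; rewrite expf_neq0// andbT gt_eqF// ltr_wpDr// ltr_wpDl.
have cpoly t : {for t, continuous (fun t => (1 - t / M%:R) ^+ M)}.
  apply: (@continuous_comp _ _ _ (fun t => 1 - t / M%:R) (fun y : R => y ^+ M)).
    apply: cvgB; first exact: cvg_cst.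
    by apply: cvgM; [exact: cvg_id|exact: cvg_cst].
  exact: exprn_continuous.
have cf t : 0 < t -> {for t, continuous f}.
  move=> t0; apply: cvgM; first exact: cvg_powR_at.
  exact: cpoly.
rewrite (@continuous_FTC2 R f F)//.
- by rewrite FM F0 sube0.
- apply/continuous_within_itvP => //; split.
  + by move=> t; rewrite in_itv/= => /andP[t0 _]; exact: cf.
  + apply: cvgM; first exact: cvg_powR_right0.
    by apply: cvg_at_right_filter; exact: cpoly.
  + by apply: cvg_at_left_filter; exact: cf.
- split => //.
  + by move=> t; rewrite in_itv/= => /andP[t0 _]; have [] := dF t t0.
  + by apply: cvg_at_left_filter; exact: is_derive_continuous (dF _ M0').
- move=> t; rewrite in_itv/= => /andP[t0 _].
  by rewrite derive1E; have [_ ->] := dF t t0.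
Qed.

End Limits.

Section GammaLimits.
Context {R : realType}.
Implicit Types (s t x y z : R).
Local Notation mu := (@lebesgue_measure R).

Lemma powR_expRN_le s : 0 <= s -> exists2 C : R, 0 <= C &
  forall t, 0 < t -> t `^ s * expR (- t) <= C * expR (- 2^-1 * t).
Proof.
move=> s0; set n := Num.bound s.
have sn : s <= n.+1%:R by apply: (le_trans (ltW (archi_boundP s0))); rewrite ler_nat.
pose C : R := 1 + 2 ^+ n.+1 * n.+1`!%:R.
have D0 : 0 <= 2 ^+ n.+1 * n.+1`!%:R :> R by rewrite mulr_ge0.
exists C => [|t t0]; first by rewrite addr_ge0.
have -> : - t = - 2^-1 * t + - 2^-1 * t by field.
rewrite expRD mulrA ler_wpM2r ?expR_ge0//.
rewrite mulNr expRN ler_pdivrMr ?expR_gt0// mulrC.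
have e1 : 1 <= expR (t / 2).
  by rewrite -expR0 ler_expR divr_ge0// ltW.
have e2 : t ^+ n.+1 <= 2 ^+ n.+1 * n.+1`!%:R * expR (t / 2).
  have := @expR_ge1Dxn R (t / 2) n.
  rewrite (divr_ge0 (ltW t0))// => /(_ isT) h.
  have {}h : (t / 2) ^+ n.+1 / n.+1`!%:R <= expR (t / 2).
    by apply: le_trans h; rewrite lerDr.
  move: h; rewrite ler_pdivrMr ?ltr0n ?fact_gt0// exprMn exprVn ler_pdivrMr ?exprn_gt0//.
  move=> h; rewrite (_ : _ * _ * _ = expR (t / 2) * n.+1`!%:R * 2 ^+ n.+1)//.
  ring.
have e3 : t `^ s <= 1 + t ^+ n.+1.
  have [t1|t1] := leP t 1.
    rewrite -[X in X <= _]addr0 lerD//; last by rewrite exprn_ge0// ltW.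
    have -> : 1 = 1 `^ s :> R by rewrite powR1.
    by apply: ge0_ler_powR; rewrite // nnegrE ltW.
  apply: (@le_trans _ _ (t ^+ n.+1)); last by rewrite lerDr.
  by rewrite -powR_mulrn ?(ltW t0)// ler_powR// (ltW t1).
rewrite mulrC (mulrC 2^-1) /C mulrDl mul1r; apply: (le_trans e3).
exact: lerD.
Qed.

Lemma measurable_gamma_integrand s : measurable_fun [set: R] (fun t => t `^ s * expR (- t)).
Proof.
apply: measurable_funM; first exact: measurable_powR.
by apply: measurableT_comp => //; exact: measurable_expR.
Qed.

Lemma measurable_beta_integrand s M :
  measurable_fun [set: R] (fun t => t `^ s * (1 - t / M%:R) ^+ M).
Proof.
apply: measurable_funM; first exact: measurable_powR.
apply: measurable_funX; apply: measurable_funB => //.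
exact: measurable_funM.
Qed.

Lemma integrable_gamma s : 0 <= s ->
  mu.-integrable `]0%R, +oo[ (fun t => (t `^ s * expR (- t))%:E).
Proof.
move=> s0; have [C C0 hC] := powR_expRN_le s0.
have half0 : 0 < 2^-1 :> R by [].
have h1 : mu.-integrable `]0%R, +oo[ (EFin \o exponential_pdf (2^-1 : R)).
  by apply: (integrableS measurableT) => //; exact: integrable_exponential_pdf.
apply: (le_integrable _ _ _ (integrableZl _ (2 * C) h1)) => //.
  by apply/measurable_EFinP; apply: measurable_funTS; exact: measurable_gamma_integrand.
move=> t /=; rewrite in_itv/= andbT => t0.
rewrite lee_fin exponential_pdfE ?(ltW t0)//.
rewrite !ger0_norm ?mulr_ge0 ?powR_ge0 ?expR_ge0//.
apply: le_trans (hC t t0) _; rewrite le_eqVlt; apply/orP; left; apply/eqP; by field.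
Qed.

(** Euler's limit formula for the Gamma function, by dominated convergence. *)
Lemma cvg_beta_value_Gamma s : 0 <= s ->
  beta_value s n.+1 @[n --> \oo] --> Gamma (1 + s).
Proof.
move=> s0.
pose h n t : R := t `^ s * (1 - t / n.+1%:R) ^+ n.+1.
pose f_ n : R -> \bar R := EFin \o (h n \_ `[0, n.+1%:R]%classic).
pose f t := (t `^ s * expR (- t))%:E.
have mh n : measurable_fun [set: R] (h n) by exact: measurable_beta_integrand.
have mf_ n : measurable_fun (`]0%R, +oo[%classic : set R) (f_ n).
  apply: measurable_funTS; apply/measurable_EFinP.
  by apply/(measurable_restrictT _ _).1 => //; apply: measurable_funTS.
have mf : measurable_fun (`]0%R, +oo[%classic : set R) f.
  by apply: measurable_funTS; apply/measurable_EFinP; exact: measurable_gamma_integrand.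
have If_ n : (\int[mu]_(t in `]0%R, +oo[) f_ n t = (beta_value s n.+1)%:E)%E.
  rewrite -integral_beta// -integral_itv_obnd_cbnd; last first.
    by apply: measurable_funTS; apply/measurable_EFinP; exact: measurable_beta_integrand.
  rewrite /f_ -restrict_EFin -integral_mkcondr.
  congr integral; apply/seteqP; split => t /=; rewrite !in_itv/= ?andbT.
    by move=> [-> /andP[_]].
  by move=> /andP[t0 ->]; rewrite t0 ltW.
have [||_ _] := @dominated_convergence _ _ _ mu (`]0%R, +oo[%classic : set R) (measurable_itv _)
  f_ f f mf_ mf _ (integrable_gamma s0) _.
- apply: aeW => t; rewrite /= in_itv/= andbT => t0.
  apply: cvg_EFin.
    by apply: nearW.
  have : h n t @[n --> \oo] --> t `^ s * expR (- t).
    by apply: cvgM; [exact: cvg_cst|exact: cvg_onem_exprn (ltW t0)].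
  apply: cvg_trans; apply: near_eq_cvg; near=> n => /=.
  rewrite /comp patchE ifT// inE/= in_itv/= ltW//=.
  by apply: ltW; near: n; exact: near_ltr_natS.
- apply: aeW => t n; rewrite /= in_itv/= andbT => t0.
  rewrite lee_fin patchE; case: ifPn => [|_]; last first.
    by rewrite normr0 mulr_ge0 ?powR_ge0 ?expR_ge0.
  rewrite inE/= in_itv/= => /andP[_ tn].
  have u0 : 0 <= 1 - t / n.+1%:R by rewrite subr_ge0 ler_pdivrMr// mul1r.
  rewrite /h ger0_norm ?mulr_ge0 ?powR_ge0 ?exprn_ge0//.
  rewrite ler_wpM2l ?powR_ge0//.
  rewrite (_ : - t = n.+1%:R * - (t / n.+1%:R)); last by field.
  by rewrite expRM_natl lerXn2r ?nnegrE ?expR_ge0// expR_ge1Dx.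
rewrite (_ : (fun n => _) = (fun n => (beta_value s n.+1)%:E)); last first.
  by apply/funext => n; rewrite If_.
move=> h1.
have -> : Gamma (1 + s) = fine (\int[mu]_(t in `]0%R, +oo[) f t).
  by rewrite /Gamma /Rintegral; congr fine; apply: eq_integral => t _; rewrite addrAC subrr add0r.
have fI : (\int[mu]_(t in `]0%R, +oo[) f t)%E \is a fin_num.
  exact: integrable_fin_num (integrable_gamma s0).
by move: h1; rewrite -(fineK fI) => /fine_cvg.
Unshelve. all: by end_near. Qed.

(** A lower bound exponential in [s], from the part of the integral between
    [L] and [L + 1]; as [L] is arbitrary, it makes the Mittag-Leffler series
    entire. *)
Lemma beta_value_ge s (L : R) M : 0 <= s -> 0 <= L -> L + 1 <= M%:R ->
  L `^ s * (1 - (L + 1) / M%:R) ^+ M <= beta_value s M.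
Proof.
move=> s0 L0 LM.
have M0 : (0 < M)%N by rewrite -(@ltr0n R); apply: lt_le_trans LM; rewrite ltr_wpDl.
have Mr : 0 < M%:R :> R by rewrite ltr0n.
rewrite -lee_fin -integral_beta//.
set c := L `^ s * _.
pose J : set R := `[L, L + 1]%classic.
have mJ : measurable J by exact: measurable_itv.
have muJ : mu J = 1%E.
  rewrite /J [LHS]lebesgue_measure_itv/= lte_fin ltrDl ltr01 -EFinD.
  by rewrite addrAC subrr add0r.
have -> : (c%:E = \int[mu]_(t in J) (cst c%:E t))%E.
  by rewrite integral_cst//= muJ mule1.
have sub : J `<=` `[0%R, M%:R]%classic.
  move=> t; rewrite /J /= !in_itv/= => /andP[t1 t2].
  by apply/andP; split; lra.
have pos t : 0 <= t <= M%:R -> 0 <= 1 - t / M%:R.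
  by move=> /andP[_ tM]; rewrite subr_ge0 ler_pdivrMr// mul1r.
have mf : measurable_fun [set: R] (fun t => (t `^ s * (1 - t / M%:R) ^+ M)%:E).
  by apply/measurable_EFinP; exact: measurable_beta_integrand.
apply: (@le_trans _ _ (\int[mu]_(t in J) (t `^ s * (1 - t / M%:R) ^+ M)%:E)%E).
  apply: ge0_le_integral => //.
  - move=> t _; rewrite lee_fin mulr_ge0 ?powR_ge0// exprn_ge0// pos// LM andbT addr_ge0//.
  - exact: measurable_funTS.
  - move=> t; rewrite /J /= in_itv/= => /andP[t1 t2]; rewrite lee_fin.
    apply: ler_pM; rewrite ?powR_ge0//.
    + by rewrite exprn_ge0// pos// LM andbT addr_ge0.
    + by apply: ge0_ler_powR => //; rewrite nnegrE// (le_trans L0).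
    + have u1 : 1 - (L + 1) / M%:R <= 1 - t / M%:R.
        by rewrite lerD2l lerN2 ler_pM2r ?invr_gt0.
      have u0 : 0 <= 1 - (L + 1) / M%:R by apply: pos; rewrite LM andbT addr_ge0.
      by rewrite lerXn2r ?nnegrE// (le_trans u0).
apply: ge0_subset_integral => //.
- exact: measurable_funTS.
- move=> t; rewrite /= in_itv/= => tM; rewrite lee_fin mulr_ge0 ?powR_ge0//.
  by rewrite exprn_ge0// pos.
Qed.

End GammaLimits.

(** * Inversion of the Laplace transform in the spectral parameter *)

Section MainLimit.
Context {R : realType}.
Implicit Types (a s t x y z : R).

(** The spacing of the nodes. *)
Definition node_step n : R := (n.+1%:R ^+ 2)^-1.

(** The nodes [node n i], [i <= n], in the variable [q]: they all lie between
    [M] and [M + 1 / M], where [M = n.+1]. *)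
Definition node n i : R := n.+1%:R + i%:R * node_step n.

Lemma node_step_gt0 n : 0 < node_step n.
Proof. by rewrite invr_gt0 exprn_gt0. Qed.

Lemma node_bound n i : (i <= n)%N ->
  n.+1%:R <= node n i <= n.+1%:R * (1 + node_step n).
Proof.
move=> ni; rewrite /node lerDl mulr_ge0 ?(ltW (node_step_gt0 n))//= mulrDr mulr1 lerD2l.
by rewrite ler_wpM2r ?(ltW (node_step_gt0 n))// ler_nat leqW.
Qed.

Lemma node_gt0 n i : 0 < node n i.
Proof. by rewrite /node ltr_pwDl// mulr_ge0// ltW// node_step_gt0. Qed.

Lemma natS_node_step n : n.+1%:R * node_step n = n.+1%:R^-1.
Proof. by rewrite /node_step; field. Qed.

(** The normalized [n]-th alternating difference of [q `^ (- 1 - s)] along the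
    nodes. As [n.+1] grows it approaches the Post-Widder functional, which
    inverts the Laplace transform; [Gamma (1 + s) * q `^ (- 1 - s)] being the
    transform of [t `^ s], its limit is [(Gamma (1 + s))^-1]. *)
Definition post_widder_coef n s : R :=
  \prod_(i < n.+1) node n i / (n`!%:R * node_step n ^+ n) *
  altdiff n (node_step n) (fun q => q `^ (- 1 - s)) n.+1%:R.

(** The confluent value of [post_widder_coef n s], obtained when all nodes are
    merged at [n.+1]; see [beta_ratioE]. *)
Definition beta_ratio n s : R :=
  (beta_value s n.+1)^-1 * (1 - - s / n.+1%:R)^-1 * (1 - - (s + 1) / n.+1%:R)^-1.

Lemma beta_ratioE n s : 0 <= s ->
  \prod_(i < n) (s + 1 + i%:R) / n`!%:R * n.+1%:R `^ (- s) = beta_ratio n s.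
Proof.
move=> s0; rewrite /beta_ratio /beta_value big_ord_recr/= big_ord_recr/= factS natrM.
have M0 : n.+1%:R != 0 :> R by [].
rewrite powRD ?M0 ?implybT// powRr1// powRN.
have f0 : n`!%:R != 0 :> R by rewrite pnatr_eq0 -lt0n fact_gt0.
have Ms0 : n.+1%:R `^ s != 0 by rewrite gt_eqF// powR_gt0.
have P0 : \prod_(i < n) (s + 1 + i%:R) != 0.
  by apply/prodf_neq0 => i _; rewrite gt_eqF// ltr_wpDr// ltr_wpDl.
have s1 : s + 1 + n%:R != 0 by rewrite gt_eqF// ltr_wpDr// ltr_wpDl.
have s2 : s + 1 + n.+1%:R != 0 by rewrite gt_eqF// ltr_wpDr// ltr_wpDl.
rewrite -natr1 in s2 M0 Ms0 *.
have s3 : n%:R + 1 - - (s + 1) != 0.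
  by rewrite (_ : n%:R + 1 - - (s + 1) = s + 1 + (n%:R + 1))//; ring.
have s4 : n%:R + 1 - - s != 0 by rewrite (_ : n%:R + 1 - - s = s + 1 + n%:R)//; ring.
by field; rewrite P0 Ms0 f0 M0 s3 s4.
Qed.

(** The mean value theorem evaluates the alternating difference at an
    intermediate point, which differs from [n.+1] by a factor at most
    [1 + node_step n]. *)
Lemma post_widder_coef_bounds n s : 0 <= s ->
  expR (- ((n.+1%:R + s) * node_step n)) * beta_ratio n s <= post_widder_coef n s
    <= expR (n.+1%:R * node_step n) * beta_ratio n s.
Proof.
move=> s0.
pose M : R := n.+1%:R; have M0 : 0 < M by [].
have d0 := node_step_gt0 n.
pose a := - 1 - s.
(* the successive derivatives of [y `^ a] *)
pose G k y := \prod_(i < k) (a - i%:R) * y `^ (a - k%:R).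
have dG k y : M <= y -> is_derive y 1 (G k) (G k.+1 y).
  move=> My; have y0 : 0 < y by apply: lt_le_trans My.
  have h := is_derive1_powR (a - k%:R) y0.
  rewrite /G big_ord_recr/= -natr1 (_ : a - (k%:R + 1) = a - k%:R - 1); last by ring.
  by rewrite -mulrA; apply: is_deriveZ.
have [xi /andP[x1 x2]] := altdiff_mean_value n d0 dG.
rewrite {1}/G big_ord0 subr0.
under eq_fun do rewrite mul1r.
move=> E.
have x0 : 0 < xi by apply: lt_le_trans x1.
have x3 : xi <= M * (1 + node_step n).
  apply: (le_trans x2); rewrite mulrDr mulr1 lerD2l ler_wpM2r ?(ltW d0)//.
  by rewrite ler_nat.
have -> : post_widder_coef n s =
  (\prod_(i < n.+1) (node n i / M)) * (xi / M) `^ (- (M + s)) * beta_ratio n s.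
  rewrite /post_widder_coef E -beta_ratioE//.
  have -> : (-1) ^+ n * node_step n ^+ n * G n xi =
     node_step n ^+ n * (\prod_(i < n) (s + 1 + i%:R) * xi `^ (a - n%:R)).
    have -> : \prod_(i < n) (s + 1 + i%:R) = (-1) ^+ n * \prod_(i < n) (a - i%:R).
      have -> : (-1) ^+ n = \prod_(i < n) (-1 : R) by rewrite prodr_const card_ord.
      rewrite -big_split/=.
      by apply: eq_bigr => i _; rewrite /a; ring.
    rewrite /G; ring.
  have -> : a - n%:R = - (M + s) by rewrite /a /M -natr1; ring.
  have -> : (xi / M) `^ (- (M + s)) = xi `^ (- (M + s)) * (M ^+ n.+1 * M `^ s).
    rewrite powRM ?invr_ge0 ?(ltW x0) ?(ltW M0)//; congr (_ * _).
    have -> : M^-1 = M `^ (-1) by rewrite powR_inv1// ltW.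
    rewrite -powRrM mulN1r opprK powRD ?(gt_eqF M0) ?implybT//.
    by rewrite /M powR_mulrn.
  have -> : \prod_(i < n.+1) (node n i / M) = (\prod_(i < n.+1) node n i) / M ^+ n.+1.
    by rewrite big_split/= prodr_const card_ord exprVn.
  rewrite -/M !powRN.
  have f0 : n`!%:R != 0 :> R by rewrite pnatr_eq0 -lt0n fact_gt0.
  have Ms0 : M `^ s != 0 by rewrite gt_eqF// powR_gt0.
  have st0 : node_step n ^+ n != 0 by rewrite expf_neq0// gt_eqF.
  have Mn0 : M ^+ n.+1 != 0 by rewrite expf_neq0// gt_eqF.
  have X0 : xi `^ (M + s) != 0 by rewrite gt_eqF// powR_gt0.
  by field; rewrite ?Ms0 ?f0 ?Mn0 ?st0 ?X0.
have b0 : 0 <= beta_ratio n s.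
  rewrite -beta_ratioE// !mulr_ge0 ?powR_ge0 ?invr_ge0//.
  by apply: prodr_ge0 => i _; rewrite !addr_ge0.
have xM : 1 <= xi / M by rewrite ler_pdivlMr// mul1r.
have xM2 : xi / M <= 1 + node_step n by rewrite ler_pdivrMr// mulrC.
have Ms : 0 <= M + s by rewrite addr_ge0// ltW.
apply/andP; split; rewrite ler_wpM2r//.
  apply: (@le_trans _ _ (1 * (xi / M) `^ (- (M + s)))); last first.
    rewrite ler_wpM2r ?powR_ge0//.
    rewrite -[X in X <= _](_ : \prod_(i < n.+1) (1 : R) = 1); last by rewrite big1.
    apply: ler_prod => i _; rewrite ler01/= ler_pdivlMr// mul1r.
    by have /andP[] := node_bound (ltn_ord i : (i <= n)%N).
  rewrite mul1r powRN expRN lef_pV2 ?posrE ?expR_gt0 ?powR_gt0//; last first.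
    by rewrite divr_gt0.
  rewrite [_ * node_step n]mulrC expRM; apply: ge0_ler_powR => //; rewrite ?nnegrE ?expR_ge0//.
    by rewrite (le_trans ler01).
  apply: (le_trans xM2); exact: expR_ge1Dx.
apply: (@le_trans _ _ (\prod_(i < n.+1) (node n i / M) * 1)).
  apply: ler_wpM2l.
    by apply: prodr_ge0 => i _; rewrite divr_ge0 ?ltW// node_gt0.
  rewrite -(powRr0 (xi / M)) ler_powR// oppr_le0//.
rewrite mulr1 expRM_natl -[X in expR _ ^+ X](card_ord n.+1) -prodr_const.
apply: ler_prod => i _; rewrite divr_ge0 ?(ltW (node_gt0 n i)) ?(ltW M0)//=.
rewrite ler_pdivrMr// mulrC.
have /andP[_ h] := node_bound (ltn_ord i : (i <= n)%N).
apply: (le_trans h); rewrite ler_wpM2l ?(ltW M0)//; exact: expR_ge1Dx.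
Qed.

Lemma cvg_beta_ratio s : 0 <= s -> Gamma (1 + s) != 0 ->
  beta_ratio n s @[n --> \oo] --> (Gamma (1 + s))^-1.
Proof.
move=> s0 G0; rewrite -[X in _ --> X]mulr1 -[X in _ --> X]mulr1.
apply: cvgM; last exact: cvg_natV_onem.
apply: cvgM; last exact: cvg_natV_onem.
by apply: cvgV => //; exact: cvg_beta_value_Gamma.
Qed.

Lemma cvg_natSV : n.+1%:R^-1 @[n --> \oo] --> (0 : R).
Proof. exact: cvg_harmonic. Qed.

Lemma cvg_post_widder_coef s : 0 <= s -> Gamma (1 + s) != 0 ->
  post_widder_coef n s @[n --> \oo] --> (Gamma (1 + s))^-1.
Proof.
move=> s0 G0; have cb := cvg_beta_ratio s0 G0.
have c1 : expR (- ((n.+1%:R + s) * node_step n)) * beta_ratio n s @[n --> \oo] -->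
    (Gamma (1 + s))^-1.
  have -> : (Gamma (1 + s))^-1 = expR 0 / Gamma (1 + s) by rewrite expR0 mul1r.
  apply: cvgM => //.
  apply: continuous_cvg; first exact: continuous_expR.
  rewrite -[X in _ --> X]oppr0; apply: cvgN.
  have -> : (fun n => (n.+1%:R + s) * node_step n) = (fun n => n.+1%:R^-1 + s * node_step n).
    by apply/funext => n; rewrite mulrDl natS_node_step.
  rewrite -[X in _ --> X]addr0; apply: cvgD; first exact: cvg_natSV.
  rewrite -[X in _ --> X](mulr0 s); apply: cvgM; first exact: cvg_cst.
  rewrite -[X in _ --> X](mulr0 0) /node_step.
  have -> : (fun n => (n.+1%:R ^+ 2)^-1) = (fun n => n.+1%:R^-1 * n.+1%:R^-1 : R).
    by apply/funext => n; rewrite expr2 invfM.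
  by apply: cvgM; exact: cvg_natSV.
have c2 : expR (n.+1%:R * node_step n) * beta_ratio n s @[n --> \oo] --> (Gamma (1 + s))^-1.
  have -> : (Gamma (1 + s))^-1 = expR 0 / Gamma (1 + s) by rewrite expR0 mul1r.
  apply: cvgM => //.
  apply: continuous_cvg; first exact: continuous_expR.
  have -> : (fun n => n.+1%:R * node_step n) = (fun n => n.+1%:R^-1).
    by apply/funext => n; rewrite natS_node_step.
  exact: cvg_natSV.
by apply: (squeeze_cvgr _ c1 c2); apply: nearW => n; exact: post_widder_coef_bounds.
Qed.

Lemma near_beta_value_ge (L : R) : 0 < L ->
  \forall n \near \oo, forall s, 0 <= s -> L `^ s * (expR (- (L + 1)) / 2) <= beta_value s n.+1.
Proof.
move=> L0; have L1 : 0 <= L + 1 by rewrite addr_ge0// ltW.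
have h := cvg_onem_exprn L1.
have e0 := expR_gt0 (- (L + 1)).
have h2 : \forall n \near \oo, expR (- (L + 1)) / 2 < (1 - (L + 1) / n.+1%:R) ^+ n.+1.
  by apply: (cvgr_gt _ h); lra.
near=> n => s s0.
apply: (@le_trans _ _ (L `^ s * (1 - (L + 1) / n.+1%:R) ^+ n.+1)).
  by rewrite ler_wpM2l ?powR_ge0// ltW//; near: n.
apply: beta_value_ge => //; first exact: ltW.
by apply: ltW; near: n; exact: near_ltr_natS.
Unshelve. all: by end_near. Qed.

(** As [L] is arbitrary, the Gamma function grows faster than any exponential. *)
Lemma Gamma1D_ge s (L : R) : 0 <= s -> 0 < L ->
  L `^ s * (expR (- (L + 1)) / 2) <= Gamma (1 + s).
Proof.
move=> s0 L0; have h := cvg_beta_value_Gamma s0.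
rewrite -(cvg_lim _ h)//; apply: limr_ge; first by apply/cvg_ex; eexists; exact: h.
have := near_beta_value_ge L0; apply: filterS => n; exact.
Qed.

Lemma Gamma1D_gt0 s : 0 <= s -> 0 < Gamma (1 + s).
Proof.
move=> s0; apply: lt_le_trans (Gamma1D_ge s0 ltr01).
by rewrite mulr_gt0 ?powR_gt0// divr_gt0// expR_gt0.
Qed.

End MainLimit.

Section ResolventLimit.
Context {R : realType}.
Implicit Types (s t x y z : R).
Variable alpha : R.
Hypothesis alpha0 : 0 < alpha.

Let weight n : R := \prod_(i < n.+1) node n i / (n`!%:R * node_step n ^+ n).

(** The polar part of [1 / (q - x `^ (alpha^-1))] at [x = q `^ alpha], divided
    by [alpha]. *)
Definition resolvent_pole x q : R := (q * (1 - x * q `^ (- alpha)))^-1.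

(** Geometric expansion of the polar part in powers of [x]. *)
Lemma cvg_resolvent_pole x q : 0 <= x -> 0 < q -> x < q `^ alpha ->
  series (fun k => q `^ (- 1 - alpha * k%:R) * x ^+ k) @ \oo --> resolvent_pole x q.
Proof.
move=> x0 q0 xq.
have qa0 : 0 < q `^ alpha by exact: powR_gt0.
have -> : (fun k => q `^ (- 1 - alpha * k%:R) * x ^+ k) = geometric q^-1 (x * q `^ (- alpha)).
  apply/funext => k; rewrite /geometric/= exprMn.
  rewrite powRD ?(gt_eqF q0) ?implybT// powR_inv1 ?ltW// -mulrN.
  rewrite mulrN -mulNr powRrM powR_mulrn ?powR_ge0//; ring.
rewrite /resolvent_pole invfM; apply: cvg_geometric_series.
rewrite ger0_norm ?mulr_ge0 ?powR_ge0// powRN.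
by rewrite ltr_pdivrMr// mul1r.
Qed.

Lemma cvg_post_widder_series n x : 0 <= x -> x < n.+1%:R `^ alpha ->
  series (fun k => post_widder_coef n (alpha * k%:R) * x ^+ k) @ \oo -->
  weight n * altdiff n (node_step n) (resolvent_pole x) n.+1%:R.
Proof.
move=> x0 xn.
have -> : series (fun k => post_widder_coef n (alpha * k%:R) * x ^+ k) =
  (fun N => weight n * \sum_(j < n.+1) (-1) ^+ j * 'C(n, j)%:R *
     series (fun k => node n j `^ (- 1 - alpha * k%:R) * x ^+ k) N).
  apply/funext => N; rewrite /series/=.
  under eq_bigr => k _.
    rewrite /post_widder_coef -/(weight n) -mulrA /altdiff mulr_suml; over.
  rewrite -mulr_sumr exchange_big/=; congr (_ * _); apply: eq_bigr => j _.
  by rewrite mulr_sumr; apply: eq_bigr => k _; rewrite /node mulrA.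
apply: cvgM; first exact: cvg_cst.
apply: cvg_sum_seq => j _; apply: cvgM; first exact: cvg_cst.
apply: cvg_resolvent_pole => //; first exact: node_gt0.
apply: (lt_le_trans xn); apply: ge0_ler_powR; rewrite ?nnegrE ?(ltW alpha0)//.
  by rewrite ltW// node_gt0.
by have /andP[] := node_bound (R := R) (ltn_ord j : (j <= n)%N).
Qed.

Lemma cvg_post_widder x : 0 < x ->
  weight n * altdiff n (node_step n) (resolvent_pole x) n.+1%:R @[n --> \oo]
    --> mittag_leffler alpha x.
Proof.
move=> x0.
have an0 : alpha != 0 by rewrite gt_eqF.
(* with this [L] the series is dominated by a geometric series of ratio 1/2 *)
pose L : R := (2 * x) `^ alpha^-1.
have x20 : 0 < 2 * x by rewrite mulr_gt0.
have L0 : 0 < L by exact: powR_gt0.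
have Lk k : L `^ (alpha * k%:R) = (2 * x) ^+ k.
  by rewrite powRrM -[L `^ alpha]powRrM mulVf ?gt_eqF// powRr1 ?ltW// powR_mulrn ?ltW.
pose c : R := expR (- (L + 1)) / 2.
have c0 : 0 < c by rewrite divr_gt0// expR_gt0.
have ak0 k : 0 <= alpha * k%:R by rewrite mulr_ge0// ltW.
pose u n k := post_widder_coef n (alpha * k%:R) * x ^+ k.
have [||||cv lim] := @tannery R u (fun k => (Gamma (1 + alpha * k%:R))^-1 * x ^+ k)
  (geometric (expR 1 / c) 2^-1)
  (fun n => weight n * altdiff n (node_step n) (resolvent_pole x) n.+1%:R).
- near=> n => k.
  have bL : forall s, 0 <= s -> L `^ s * c <= beta_value s n.+1.
    by near: n; exact: near_beta_value_ge.
  have /andP[b1 b2] := post_widder_coef_bounds n (ak0 k).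
  have B0 : 0 < beta_value (alpha * k%:R) n.+1.
    by apply: lt_le_trans (bL _ (ak0 k)); rewrite mulr_gt0// powR_gt0.
  have r0 : 0 <= beta_ratio n (alpha * k%:R).
    rewrite /beta_ratio !mulr_ge0 ?invr_ge0 ?(ltW B0)// mulNr opprK addr_ge0//
      divr_ge0// addr_ge0//.
  have w0 : 0 <= post_widder_coef n (alpha * k%:R).
    by apply: le_trans b1; rewrite mulr_ge0// expR_ge0.
  rewrite /u ger0_norm; last by apply: mulr_ge0 => //; rewrite exprn_ge0// ltW.
  have -> : geometric (expR 1 / c) 2^-1 k = expR 1 * ((2 * x) ^+ k * c)^-1 * x ^+ k.
    rewrite /geometric/= exprMn exprVn; field.
    by rewrite !expf_neq0 ?gt_eqF.
  rewrite ler_wpM2r ?exprn_ge0 ?(ltW x0)//; apply: (le_trans b2).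
  apply: ler_pM; rewrite ?expR_ge0//.
    by rewrite ler_expR natS_node_step invf_le1// ler1n.
  apply: (@le_trans _ _ (beta_value (alpha * k%:R) n.+1)^-1).
    rewrite /beta_ratio -mulrA ler_piMr ?invr_ge0 ?(ltW B0)//.
    have h y : 0 <= y -> 0 <= (1 - - y / n.+1%:R)^-1 <= 1.
      move=> y0; have y1 : 1 <= 1 - - y / n.+1%:R by rewrite mulNr opprK lerDl divr_ge0.
      by rewrite invr_ge0 (le_trans ler01)//= invf_le1// (lt_le_trans ltr01).
    have /andP[h1 h2] := h _ (ak0 k).
    have /andP[h3 h4] := h _ (addr_ge0 (ak0 k) ler01).
    by rewrite mulr_ile1.
  have Lc0 : 0 < (2 * x) ^+ k * c by rewrite mulr_gt0// exprn_gt0.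
  by rewrite lef_pV2 ?posrE// -Lk bL.
- by apply: is_cvg_geometric_series; rewrite ger0_norm// invf_lt1// ltr1n.
- move=> k; apply: cvgM; last exact: cvg_cst.
  by apply: cvg_post_widder_coef => //; rewrite gt_eqF// Gamma1D_gt0.
- near=> n; apply: cvg_post_widder_series; first exact: ltW.
  rewrite -[x](powRr1 (ltW x0)) -[X in x `^ X](mulVf an0) powRrM.
  apply: ltr_powR; rewrite ?powR_ge0//.
  by near: n; exact: near_ltr_natS.
exact: lim.
Unshelve. all: by end_near. Qed.

(** The value of [x] at which [node n i - x `^ (alpha^-1)] vanishes. *)
Definition pole n i : R := node n i `^ alpha.

Lemma resolvent_part_poleE n x : 0 < x -> x < n.+1%:R `^ alpha ->
  (\prod_(i < n.+1) node n i) * resolvent_part alpha^-1 (pole n) n.+1 x =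
  \prod_(i < n.+1) (1 - x `^ alpha^-1 / node n i)^-1 -
  alpha * (weight n * altdiff n (node_step n) (resolvent_pole x) n.+1%:R).
Proof.
move=> x0 xn.
have an0 : alpha != 0 by rewrite gt_eqF.
have nd0 i : 0 < node n i :> R by exact: node_gt0.
have poleK i : pole n i `^ alpha^-1 = node n i.
  by rewrite /pole -powRrM divff// powRr1// ltW.
have xnode i : (i <= n)%N -> x < pole n i.
  move=> ni; apply: (lt_le_trans xn); apply: ge0_ler_powR;
    rewrite ?nnegrE ?(ltW alpha0) ?(ltW (nd0 i))//.
  by have /andP[] := node_bound (R := R) ni.
rewrite /resolvent_part mulrBr; congr (_ - _).
  rewrite -big_split/=; apply: eq_bigr => i _; rewrite poleK.
  by rewrite -[X in X * _]invrK -invfM mulrBr mulVf ?gt_eqF// [_^-1 * _]mulrC.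
rewrite /weight /altdiff !mulr_sumr; apply: eq_bigr => i _.
have ni : (i <= n)%N by rewrite -ltnS.
have -> : \prod_(j < n.+1) (if j == i :> nat then 1
      else pole n j `^ alpha^-1 - pole n i `^ alpha^-1)^-1 =
    ((-1) ^+ i * i`!%:R * (n - i)`!%:R * node_step n ^+ n)^-1.
  rewrite -(@prod_equidistant R (node n))//; last first.
    by move=> k; rewrite /node mul0r addr0.
  by rewrite prodfV; congr (_^-1); apply: eq_bigr => j _; rewrite !poleK.
have -> : (alpha^-1 * pole n i `^ (alpha^-1 - 1) * (pole n i - x))^-1 =
    alpha * resolvent_pole x (node n i).
  rewrite /resolvent_pole -mulrA invfM invrK; congr (_ * _^-1).
  have e : alpha * (alpha^-1 - 1) = 1 - alpha by rewrite mulrBr mulfV// mulr1.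
  rewrite /pole -powRrM e powRN.
  have qa0 : node n i `^ alpha != 0 by rewrite gt_eqF// powR_gt0.
  rewrite powRD ?(gt_eqF (nd0 i)) ?implybT// powRN powRr1 ?(ltW (nd0 i))//.
  by field.
have -> : n`!%:R = 'C(n, i)%:R * (i`!%:R * (n - i)`!%:R) :> R.
  by rewrite -!natrM bin_fact.
have f1 : i`!%:R != 0 :> R by rewrite pnatr_eq0 -lt0n fact_gt0.
have f2 : (n - i)`!%:R != 0 :> R by rewrite pnatr_eq0 -lt0n fact_gt0.
have f3 : 'C(n, i)%:R != 0 :> R by rewrite pnatr_eq0 -lt0n bin_gt0.
have f4 : node_step n ^+ n != 0 :> R by rewrite expf_neq0// gt_eqF// node_step_gt0.
rewrite -/(node n i) -signr_odd.
by case: odd; rewrite ?expr0 ?expr1; field; rewrite f1 f2 f3 f4.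
Qed.

End ResolventLimit.

Section AltdiffTarget.
Context {R : realType}.
Implicit Types (s t x y z : R).

(** The function whose complete monotonicity is studied. *)
Definition exp_ml_gap (alpha x : R) : R :=
  expR (x `^ alpha^-1) / alpha - mittag_leffler alpha x.

Lemma cvg_resolvent_part_exp_ml_gap alpha x : 0 < alpha -> 0 < x ->
  (\prod_(i < n.+1) node n i) / alpha *
    resolvent_part alpha^-1 (pole alpha n) n.+1 x @[n --> \oo] --> exp_ml_gap alpha x.
Proof.
move=> a0 x0; have an0 : alpha != 0 by rewrite gt_eqF.
have c1 : \prod_(i < n.+1) (1 - x `^ alpha^-1 / node n i)^-1 @[n --> \oo]
    --> expR (x `^ alpha^-1).
  apply: cvg_prod_expR; first exact: powR_ge0.
  move=> n i ni; have /andP[-> h] := node_bound (R := R) ni.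
  apply: (le_trans h); rewrite mulrDr mulr1 natS_node_step lerD2l.
  by rewrite invf_le1// ler1n.
have c2 := cvg_post_widder a0 x0.
have c3 : (\prod_(i < n.+1) (1 - x `^ alpha^-1 / node n i)^-1) / alpha -
    (\prod_(i < n.+1) node n i / (n`!%:R * node_step n ^+ n)) *
      altdiff n (node_step n) (resolvent_pole alpha x) n.+1%:R @[n --> \oo] --> exp_ml_gap alpha x.
  by apply: cvgB => //; apply: cvgM => //; exact: cvg_cst.
apply: cvg_trans c3; apply: near_eq_cvg; near=> n.
rewrite [RHS]mulrAC resolvent_part_poleE//.
  by rewrite mulrBl; congr (_ - _); rewrite [RHS]mulrAC divff// mul1r.
rewrite -[x](powRr1 (ltW x0)) -[X in x `^ X](mulVf an0) powRrM.
apply: ltr_powR; rewrite ?powR_ge0//.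
by near: n; exact: near_ltr_natS.
Unshelve. all: by end_near. Qed.

Lemma altdiff_exp_ml_gap_ge0 alpha m d x : 1 / 2 <= alpha < 1 -> 0 < d -> 0 < x ->
  0 <= altdiff m d (exp_ml_gap alpha) x.
Proof.
move=> /andP[a12 a1] d0 x0.
have a0 : 0 < alpha by apply: lt_le_trans a12; rewrite divr_gt0.
have an0 : alpha != 0 by rewrite gt_eqF.
have b12 : 1 <= alpha^-1 <= 2.
  rewrite invf_ge1 ?(ltW a1)//= -[X in _ <= X]invrK lef_pV2 ?posrE//.
  by rewrite -[X in X <= _]mul1r.
have c : altdiff m d (fun y => (\prod_(i < n.+1) node n i) / alpha *
    resolvent_part alpha^-1 (pole alpha n) n.+1 y) x @[n --> \oo] -->
    altdiff m d (exp_ml_gap alpha) x.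
  apply: cvg_sum_seq => j _; apply: cvgM; first exact: cvg_cst.
  by apply: cvg_resolvent_part_exp_ml_gap => //; rewrite ltr_wpDr// mulr_ge0// ltW.
rewrite -(cvg_lim _ c)//; apply: limr_ge; first by apply/cvg_ex; eexists; exact: c.
near=> n.
rewrite altdiffZ mulr_ge0//.
  by rewrite divr_ge0 ?(ltW a0)// prodr_ge0// => i _; rewrite ltW// node_gt0.
have xm0 : 0 <= x + m%:R * d by rewrite addr_ge0 ?(ltW x0)// mulr_ge0// ltW.
apply: altdiff_resolvent_part_ge0 => //.
  move=> i j /andP[ij jn]; rewrite lt_eqF//; apply: ltr_powR => //.
    by rewrite ltW// node_gt0.
  by rewrite ltrD2l ltr_pM2r ?node_step_gt0// ltr_nat.
move=> i ni.
rewrite -[_ + _](powRr1 xm0) -[X in _ `^ X](mulVf an0) powRrM.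
apply: ltr_powR; rewrite ?powR_ge0//.
have /andP[+ _] := node_bound (R := R) (ni : (i <= n)%N).
apply: lt_le_trans.
by near: n; exact: near_ltr_natS.
Unshelve. all: by end_near. Qed.

End AltdiffTarget.

(** * Smoothness and the derivatives *)

Section Smooth.
Context {R : realType}.
Implicit Types (b d e s t x y alpha : R) (f : R -> R) (g : nat -> R -> R).

(** On the positive half-line, [g n.+1] is the derivative of [g n]. *)
Definition derivative_family g := forall n x, 0 < x -> is_derive x 1 (g n) (g n.+1 x).

Lemma derive1n_family f g : (forall x, 0 < x -> f x = g 0%N x) -> derivative_family g ->
  forall n x, 0 < x -> derive1n n f x = g n x /\ derivable (derive1n n f) x 1.
Proof.
move=> fg dg.
have near_pos x : 0 < x -> \forall y \near x, 0 < y.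
  by move=> x0; exact: lt_nbhsr.
suff H n x : 0 < x -> derive1n n f x = g n x.
  move=> n x x0; split; first exact: H.
  have dn := dg n x x0; apply: (near_eq_derivable _ (@ex_derive _ _ _ _ _ _ _ dn)).
  by apply: filterS (near_pos x x0) => y y0; rewrite H.
elim: n x => [|n IH] x x0; first exact: fg.
rewrite derive1nS derive1E.
have dn := dg n x x0.
rewrite -(@derive_val _ _ _ _ _ _ _ dn); apply: near_eq_derive.
by apply: filterS (near_pos x x0) => y y0; rewrite IH.
Qed.

Lemma altdiff_ge0_derive_family g : derivative_family g ->
  (forall m d x, 0 < d -> 0 < x -> 0 <= altdiff m d (g 0%N) x) ->
  forall n x, 0 < x -> 0 <= (-1) ^+ n * g n x.
Proof.
move=> dg g0 n x x0; rewrite leNgt; apply/negP => neg.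
have cg : {for x, continuous (fun y => (-1) ^+ n * g n y)}.
  apply: cvgM; first exact: cvg_cst.
  exact: is_derive_continuous (dg n x x0).
have : \forall y \near x, (-1) ^+ n * g n y < 0 by exact: (cvgr_lt _ cg).
move=> /nbhs_ballP[e /= e0 he].
(* the [n]-th difference with this step only sees points at distance less than [e] *)
pose d := e / 2 / n.+1%:R.
have d0 : 0 < d by rewrite !divr_gt0.
have [|xi /andP[x1 x2] E] := @altdiff_mean_value R n d x g d0.
  by move=> k y xy; apply: dg; exact: lt_le_trans xy.
have := g0 n d x d0 x0; rewrite E mulrAC pmulr_lge0 ?exprn_gt0//.
rewrite leNgt => /negP; apply; apply: he; rewrite /ball/= distrC ger0_norm ?subr_ge0//.
rewrite ltrBlDl; apply: (le_lt_trans x2); rewrite ltrD2l.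
apply: (@le_lt_trans _ _ (e / 2)); last by rewrite ltr_pdivrMr// ltr_pMr// ltr1n.
have e20 : 0 <= e / 2 by rewrite divr_ge0// ltW.
by rewrite /d mulrA ler_pdivrMr// mulrC ler_wpM2l// ler_nat.
Qed.

Lemma completely_monotonic_family f g : (forall x, 0 < x -> f x = g 0%N x) -> derivative_family g ->
  (completely_monotonic f <-> forall n x, 0 < x -> 0 <= (-1) ^+ n * g n x).
Proof.
move=> fg dg; have H := derive1n_family fg dg; split=> [[_ cm] n x x0|h].
  by have [<- _] := H n x x0; exact: cm.
split=> n x x0; first by have [] := H n x x0.
by have [-> _] := H n x x0; exact: h.
Qed.

(** Coefficients of power series of infinite radius of convergence,
    characterized by Cauchy's estimates. *)
Definition entire_coef (c : nat -> R) := forall K : R, 0 < K ->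
  exists C : R, forall k, `|c k| <= C / K ^+ k.

(** The factor [k.+1] brought by differentiation is absorbed by the estimate
    for [2 * K]. *)
Lemma entire_coef_diffs c : entire_coef c -> entire_coef (pseries_diffs c).
Proof.
move=> ec K K0; have [|C hC] := ec (2 * K); first by rewrite mulr_gt0.
exists (C / K) => k; rewrite /pseries_diffs normrM ger0_norm//.
have C0 : 0 <= C by have := hC 0%N; rewrite expr0 divr1; exact: le_trans.
apply: (@le_trans _ _ (2 ^+ k.+1 * (C / (2 * K) ^+ k.+1))).
  by apply: ler_pM => //; rewrite -natrX ler_nat ltnW// ltn_expl.
rewrite exprMn [K ^+ k.+1]exprS le_eqVlt; apply/orP; left; apply/eqP.
by field; rewrite !expf_neq0// gt_eqF.
Qed.

Lemma is_cvg_entire c x : entire_coef c -> cvgn (pseries c x).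
Proof.
move=> ec.
have K0 : 0 < 2 * (`|x| + 1) by rewrite mulr_gt0// ltr_wpDl.
have [C hC] := ec _ K0.
have C0 : 0 <= C by have := hC 0%N; rewrite expr0 divr1; exact: le_trans.
apply: normed_cvg.
apply: (@series_le_cvg _ _ (geometric C (`|x| / (2 * (`|x| + 1))))) => [k|k|k|] /=.
- by [].
- by rewrite mulr_ge0// exprn_ge0// divr_ge0// ltW.
- by rewrite normrM normrX exprMn exprVn mulrA mulrAC ler_wpM2r.
- apply: is_cvg_geometric_series; rewrite ger0_norm ?divr_ge0 ?(ltW K0)//.
  rewrite ltr_pdivrMr// mul1r; have := normr_ge0 x; lra.
Qed.

Lemma is_derive_entire c x : entire_coef c ->
  is_derive x 1 (fun y => limn (pseries c y)) (limn (pseries (pseries_diffs c) x)).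
Proof.
move=> ec; have ec1 := entire_coef_diffs ec; have ec2 := entire_coef_diffs ec1.
apply: (@pseries_snd_diffs R c (`|x| + 1)); try exact: is_cvg_entire.
by rewrite [X in _ < X]ger0_norm ?addr_ge0// ltrDl.
Qed.

(** The coefficients of the Mittag-Leffler series. *)
Definition ml_coef alpha (n : nat) : R := (Gamma (1 + alpha * n%:R))^-1.

Lemma ml_coef_gt0 alpha n : 0 < alpha -> 0 < ml_coef alpha n.
Proof. by move=> a0; rewrite invr_gt0 Gamma1D_gt0// mulr_ge0// ltW. Qed.

Lemma entire_ml_coef alpha : 0 < alpha -> entire_coef (ml_coef alpha).
Proof.
move=> a0 K K0; have L0 : 0 < K `^ alpha^-1 by exact: powR_gt0.
have an0 : alpha != 0 by rewrite gt_eqF.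
set L := K `^ alpha^-1 in L0.
have c0 : 0 < expR (- (L + 1)) / 2 by rewrite divr_gt0// expR_gt0.
exists (expR (- (L + 1)) / 2)^-1 => k.
have ak0 : 0 <= alpha * k%:R by rewrite mulr_ge0// ltW.
rewrite ger0_norm; last by rewrite ltW// ml_coef_gt0.
have G0 := Gamma1D_gt0 ak0.
have Kc0 : 0 < expR (- (L + 1)) / 2 * K ^+ k by rewrite (mulr_gt0 c0)// exprn_gt0.
rewrite -invfM lef_pV2 ?posrE//.
have := Gamma1D_ge ak0 L0.
rewrite powRrM -[L `^ alpha]powRrM mulVf// powRr1 ?(ltW K0)// powR_mulrn ?(ltW K0)//.
by rewrite mulrC.
Qed.

(** Finite sums of real powers, encoded by lists of pairs (coefficient,
    exponent). *)
Definition genpoly (l : seq (R * R)) x : R := \sum_(z <- l) z.1 * x `^ z.2.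

(** The operation on such sums induced by the derivative of
    [expR (y `^ b) * genpoly l y]. *)
Definition genpoly_next b (l : seq (R * R)) : seq (R * R) :=
  [seq (z.1 * z.2, z.2 - 1) | z <- l] ++ [seq (z.1 * b, z.2 + (b - 1)) | z <- l].

Lemma is_derive_genpoly_expR b l x : 0 < x ->
  is_derive x 1 (fun y => expR (y `^ b) * genpoly l y)
    (expR (x `^ b) * genpoly (genpoly_next b l) x).
Proof.
move=> x0.
have d1 : is_derive x 1 (fun y => expR (y `^ b)) (expR (x `^ b) * (b * x `^ (b - 1))).
  by have := @is_derive_comp1 R expR (fun y => y `^ b) x _ _
    (is_derive_expR _) (is_derive1_powR b x0).
have d2 : is_derive x 1 (genpoly l) (\sum_(z <- l) z.1 * (z.2 * x `^ (z.2 - 1))).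
  apply: (@is_derive_sum_seq R _ l (fun z y => z.1 * y `^ z.2)
    (fun z y => z.1 * (z.2 * y `^ (z.2 - 1)))) => z _.
  by apply: is_deriveZ; exact: is_derive1_powR.
have := is_deriveM d1 d2.
suff -> : expR (x `^ b) * genpoly (genpoly_next b l) x =
  expR (x `^ b) *: (\sum_(z <- l) z.1 * (z.2 * x `^ (z.2 - 1))) +
   genpoly l x *: (expR (x `^ b) * (b * x `^ (b - 1))) by [].
rewrite /GRing.scale/= [genpoly l x * _]mulrCA -mulrDr; congr (_ * _).
rewrite /genpoly big_cat !big_map/=; congr (_ + _).
  by apply: eq_bigr => z _; rewrite mulrA.
rewrite mulr_suml; apply: eq_bigr => z _.
rewrite powRD ?(gt_eqF x0) ?implybT//; ring.
Qed.

(** The successive derivatives of [exp_ml_gap alpha]. *)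
Definition exp_ml_gap_family alpha (n : nat) x : R :=
  expR (x `^ alpha^-1) * genpoly (iter n (genpoly_next alpha^-1) [:: (alpha^-1, 0)]) x
  - limn (pseries (iter n (@pseries_diffs R) (ml_coef alpha)) x).

Lemma exp_ml_gap_familyP alpha : 0 < alpha -> derivative_family (exp_ml_gap_family alpha).
Proof.
move=> a0 n x x0; apply: is_deriveB; first exact: is_derive_genpoly_expR.
apply: is_derive_entire.
by elim: n => [|n IH]; [exact: entire_ml_coef|exact: entire_coef_diffs].
Qed.

Lemma exp_ml_gap_family0 alpha x : exp_ml_gap_family alpha 0%N x = exp_ml_gap alpha x.
Proof. by rewrite /exp_ml_gap_family /exp_ml_gap /genpoly big_seq1/= powRr0 mulr1. Qed.

(** The constant term alone bounds from below the second derivative of the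
    Mittag-Leffler series. *)
Lemma exp_ml_gap_family2_le alpha x : 0 < alpha -> 0 < x ->
  0 <= exp_ml_gap_family alpha 2 x ->
  2 * ml_coef alpha 2 <= expR (x `^ alpha^-1) *
    (alpha^-1 * alpha^-1 * (alpha^-1 - 1) * x `^ (alpha^-1 - 2) +
     alpha^-1 * alpha^-1 * alpha^-1 * x `^ (2 * (alpha^-1 - 1))).
Proof.
move=> a0 x0; rewrite subr_ge0 => h.
have e2 : entire_coef (pseries_diffs (pseries_diffs (ml_coef alpha))).
  by do 2 apply: entire_coef_diffs; exact: entire_ml_coef.
apply: (@le_trans _ _ (limn (pseries (pseries_diffs (pseries_diffs (ml_coef alpha))) x))).
  have -> : 2 * ml_coef alpha 2 = pseries (pseries_diffs (pseries_diffs (ml_coef alpha))) x 1.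
    by rewrite /pseries/series/= big_nat1 /pseries_diffs expr0 mul1r mulr1.
  apply: nondecreasing_cvgn_le; last exact: is_cvg_entire.
  apply: nondecreasing_series => k _ _; rewrite /pseries_diffs.
  by rewrite !mulr_ge0 ?exprn_ge0 ?(ltW x0) ?(ltW (ml_coef_gt0 _ a0)).
apply: (le_trans h); rewrite le_eqVlt; apply/orP; left; apply/eqP; congr (_ * _).
rewrite /genpoly/= !big_cons big_nil/= !(mulr0, mul0r, add0r, addr0).
congr (_ * _ `^ _ + _ * _ `^ _); ring.
Qed.

(** For [alpha < 1 / 2], the upper bound given by [exp_ml_gap_family2_le]
    tends to 0 with [x]. *)
Lemma exp_ml_gap_alpha_ge alpha : 0 < alpha < 1 ->
  (forall x, 0 < x -> 0 <= exp_ml_gap_family alpha 2 x) -> 1 / 2 <= alpha.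
Proof.
move=> /andP[a0 a1] h; rewrite leNgt; apply/negP => a2.
have an0 : alpha != 0 by rewrite gt_eqF.
have b2 : 2 < alpha^-1.
  by rewrite -[X in X < _]invrK ltf_pV2 ?posrE// -[X in _ < X]mul1r.
set b := alpha^-1 in b2.
pose f x : R := expR (x `^ b) *
    (b * b * (b - 1) * x `^ (b - 2) + b * b * b * x `^ (2 * (b - 1))).
have c : f x @[x --> 0^'+] --> expR 0 * (b * b * (b - 1) * 0 + b * b * b * 0).
  apply: cvgM.
    by apply: continuous_cvg; [exact: continuous_expR|apply: powR_cvg0; lra].
  apply: cvgD; (apply: cvgM; [exact: cvg_cst|apply: powR_cvg0; lra]).
rewrite !mulr0 addr0 mulr0 in c.
have : 2 * ml_coef alpha 2 <= 0.
  rewrite -(cvg_lim _ c)//; apply: limr_ge; first by apply/cvg_ex; eexists; exact: c.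
  near=> x; have x0 : 0 < x by near: x; exact: nbhs_right_gt.
  by apply: exp_ml_gap_family2_le => //; exact: h.
by rewrite leNgt => /negP; apply; rewrite mulr_gt0// ml_coef_gt0.
Unshelve. all: by end_near. Qed.

End Smooth.

(** * The characterization *)

Theorem proposition1 (R : realType) (alpha : R)
  (halpha : 0 < alpha < 1) :
  completely_monotonic
    (fun x : R => expR (x `^ alpha^-1) / alpha - mittag_leffler alpha x)
  <-> 1 / 2 <= alpha.
Proof.
have /andP[a0 a1] := halpha.
rewrite (completely_monotonic_family (g := exp_ml_gap_family alpha)); last 2 first.
- by move=> x _; rewrite exp_ml_gap_family0.
- exact: exp_ml_gap_familyP.
split=> [h|a2].
  apply: exp_ml_gap_alpha_ge => // x x0.
  by have := h 2 x x0; rewrite expr2 mulrNN mulr1 mul1r.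
apply: altdiff_ge0_derive_family; first exact: exp_ml_gap_familyP.
move=> m d x d0 x0.
rewrite (_ : exp_ml_gap_family alpha 0 = exp_ml_gap alpha); last first.
  by apply/funext => y; exact: exp_ml_gap_family0.
by apply: altdiff_exp_ml_gap_ge0 => //; rewrite a2.
Qed.
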